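(* Let $n\ge1$ and let $\kappa(n):=\|e_1\vee\cdots\vee e_n\|_{\pi s+,\ell_1^n}$; then $\kappa(n)=c_{\pi,s+}(n,\ell_1)$. (i) If $\mathbf{X}=(X_1,\dots,X_n)$ is an exchangeable random vector with values in $S^n$, where $S$ is an arbitrary measurable space, then its distribution $\mu_{\mathbf{X}}\in\mathcal P(S^n)$ has a representation $$\mu_{\mathbf{X}}=\int_{\mathcal P(S)}\nu^n\,d\lambda(\nu)\qquad(\ast)$$ (meaning $\mu_{\mathbf{X}}(A)=\int_{\mathcal P(S)}\nu^n(A)\,d\lambda(\nu)$ for all measurable $A\subseteq S^n$, where $\nu^n$ is the product measure) with a signed measure $\lambda\in\mathcal M(\mathcal P(S))$ satisfying $\|\lambda\|_{\mathcal M(\mathcal P(S))}\le\kappa(n)$. The constant $\kappa(n)$ is in general best possible: there exist a measurable space $S$ and an exchangeable $\mathbf X$ in $S^n$ such that every signed measure $\lambda$ satisfying $(\ast)$ has $\|\lambda\|\ge\kappa(n)$. Moreover, $$\frac{n^n}{n!}\le\kappa(n)\le2^{n-1}\frac{n^n}{n!}.$$ (ii) If furthermore $S$ is finite with $|S|=m$, then $\lambda$ in $(\ast)$ can be chosen with $\|\lambda\|_{\mathcal M(\mathcal P(S))}\le c_{\pi,s+}(n,\ell_1^m)$, and this constant is best possible for the given $S$, i.e. it is the smallest constant $M$ such that every exchangeable distribution on $S^n$ has a representation $(\ast)$ with $\|\lambda\|\le M$. If $m\ge n$, then $c_{\pi,s+}(n,\ell_1^m)=\kappa(n)$.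
   Context: For a measurable space $S$, $\mathcal M(S)$ is the space of finite signed measures on $S$ with total variation norm, and $\mathcal P(S)\subseteq\mathcal M(S)$ the probability measures; $\mathcal P(S)$ is given the $\sigma$-field generated by the maps $\mu\mapsto\mu(A)$, $A\subseteq S$ measurable, and $\mathcal M(\mathcal P(S))$ denotes finite signed measures on this measurable space. A random vector $(X_1,\dots,X_n)$ in $S^n$ is exchangeable if its distribution is invariant under permutations of the coordinates. Tensor notation (real scalars): for a normed space $E$, $E^{\otimes n}$ is the algebraic tensor power, $E^{\vee n}$ the symmetric tensors, $x^{\otimes n}:=x\otimes\cdots\otimes x$, $x_1\vee\cdots\vee x_n:=\frac1{n!}\sum_{\sigma\in\mathfrak S_n}x_{\sigma(1)}\otimes\cdots\otimes x_{\sigma(n)}$; $\|\mathbf{x}\|_{\pi,E}:=\inf\{\sum_k|a_k|\prod_i\|x_{ik}\| : \mathbf{x}=\sum_k a_k x_{1k}\otimes\cdots\otimes x_{nk}\}$. $\ell_1^m$ ($1\le m<\infty$) is $\mathbb{R}^m$ with the $\ell_1$-norm and $\ell_1=\ell_1^\infty$, ordered coordinatewise (positive = nonnegative coordinates), with standard basis $(e_i)$. For $E=\ell_1^m$ (or $\ell_1$), $\|\mathbf{x}\|_{\pi s+,E}:=\inf\{\sum_k|a_k|\,\|x_k\|^n : \mathbf{x}=\sum_k a_k x_k^{\otimes n},\ x_k\ge0\}$ (finite sums), and $c_{\pi,s+}(n,E):=\sup\{\|\mathbf{x}\|_{\pi s+,E}/\|\mathbf{x}\|_{\pi,E}: 0\ne\mathbf{x}\in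 E^{\vee n}\}$. *)

(* Defs.v *)
From HB Require Import structures.
From mathcomp Require Import all_boot all_order all_algebra all_fingroup.
From mathcomp Require Import all_classical all_reals all_analysis.

Set Implicit Arguments.
Unset Strict Implicit.
Unset Printing Implicit Defensive.

Import Order.TTheory GRing.Theory Num.Theory.
Import numFieldNormedType.Exports.

Local Open Scope classical_set_scope.
Local Open Scope ring_scope.

(* Tensor part.  The Banach space is ell_1(I) with I = 'I_m (ell_1^m)   *)
(* or I = nat (ell_1).  Vectors are functions I -> R.  An element of    *)
(* the algebraic tensor power E^{(x)n} is represented through its       *)
(* canonical (injective) image as a function ('I_n -> I) -> R, namely   *)
(* (x_1 (x) ... (x) x_n)(j) = prod_i x_i (j i), extended linearly.      *)
Section Tensors.
Variables (R : realType) (I : choiceType) (n : nat).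

Definition l1norm (x : I -> R) : \bar R := (\esum_(i in [set: I]) (`|x i|)%:E)%E.

Definition in_l1 (x : I -> R) : Prop := (l1norm x < +oo)%E.

Definition vpos (x : I -> R) : Prop := forall i, 0 <= x i.

Definition tensor := ('I_n -> I) -> R.

Definition elem_tensor (x : 'I_n -> I -> R) : tensor :=
  fun j => \prod_(i < n) x i (j i).

Definition tcomb (k : nat) (a : 'I_k -> R) (x : 'I_k -> 'I_n -> I -> R) : tensor :=
  fun j => \sum_(l < k) a l * elem_tensor (x l) j.

Definition is_tensor (t : tensor) : Prop :=
  exists k (a : 'I_k -> R) (x : 'I_k -> 'I_n -> I -> R),
    (forall l i, in_l1 (x l i)) /\ t = tcomb a x.

Definition is_sym (t : tensor) : Prop :=
  forall s : 'S_n, t = (fun j => t (fun i => j (s i))).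

Definition pi_norm (t : tensor) : \bar R :=
  ereal_inf [set r | exists k (a : 'I_k -> R) (x : 'I_k -> 'I_n -> I -> R),
    [/\ (forall l i, in_l1 (x l i)), t = tcomb a x &
        r = (\sum_(l < k) `|a l| * \prod_(i < n) fine (l1norm (x l i)))%:E]].

Definition pis_norm (t : tensor) : \bar R :=
  ereal_inf [set r | exists k (a : 'I_k -> R) (x : 'I_k -> I -> R),
    [/\ (forall l, in_l1 (x l) /\ vpos (x l)),
        t = tcomb a (fun l _ => x l) &
        r = (\sum_(l < k) `|a l| * (fine (l1norm (x l))) ^+ n)%:E]].

Definition c_pis : \bar R :=
  ereal_sup [set r | exists t : tensor,
    [/\ is_tensor t, is_sym t, t <> (fun _ => 0) &
        r = (pis_norm t * ((fine (pi_norm t))^-1)%:E)%E]].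

End Tensors.

Definition basis_vec (R : realType) (m : nat) (k : 'I_m) : 'I_m -> R :=
  fun i => if i == k then 1 else 0.

Definition sym_basis (R : realType) (n : nat) : tensor R 'I_n n :=
  fun j => ((factorial n)%:R)^-1 *
    \sum_(s : 'S_n) elem_tensor (fun i => basis_vec R (s i)) j.

Definition kappa (R : realType) (n : nat) : \bar R :=
  pis_norm (@sym_basis R n).

(* P(S) with the sigma-field generated by mu |-> mu(A) (library:        *)
(* pprobability, generated by the sets {mu | mu U < r}, U measurable,   *)
(* r in [0,1], which is the same sigma-field).                          *)
Notation PS S R := (pprobability S R).

Section Measures.
Context {R : realType}.

Lemma hahn_sig d (T : measurableType d) (la : {charge set T -> \bar R}) :
  {PN : set T * set T | hahn_decomposition la PN.1 PN.2}.
Proof.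
apply: cid; have [P [N h]] := Hahn_decomposition la.
by exists (P, N).
Qed.

Definition tvnorm d (T : measurableType d) (la : {charge set T -> \bar R}) : \bar R :=
  charge_variation (projT2 (hahn_sig la)) setT.

Definition cintegral d (T : measurableType d) (la : {charge set T -> \bar R})
    (f : T -> \bar R) : \bar R :=
  (\int[jordan_pos (projT2 (hahn_sig la))]_x f x
   - \int[jordan_neg (projT2 (hahn_sig la))]_x f x)%E.

Context {d : measure_display} {S : measurableType d}.

Fixpoint iprod (nu : probability S R) (n : nat) : (n.-tuple S -> \bar R) -> \bar R :=
  match n with
  | 0 => fun f => f [tuple]
  | k.+1 => fun f => (\int[nu]_x iprod nu (fun t => f (cons_tuple x t)))%E
  end.

Definition nu_pow (n : nat) (nu : probability S R) (A : set (n.-tuple S)) : \bar R :=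
  iprod nu (fun t => (\1_A t)%:E).

Definition permt (n : nat) (s : 'S_n) (t : n.-tuple S) : n.-tuple S :=
  [tuple tnth t (s i) | i < n].

Definition exchangeable (n : nat) (mu : set (n.-tuple S) -> \bar R) : Prop :=
  forall (s : 'S_n) (A : set (n.-tuple S)), measurable A ->
    mu (permt s @^-1` A) = mu A.

Definition represents (n : nat) (la : {charge set PS S R -> \bar R})
    (mu : set (n.-tuple S) -> \bar R) : Prop :=
  forall A : set (n.-tuple S), measurable A ->
    mu A = cintegral la (fun nu : probability S R => nu_pow nu A).

End Measures.

(* Main.v *)
(** A representation [e_1 \/ ... \/ e_n = \sum_k b_k y_k^{(x)n}] with [y_k] in the simplex
    is universal. Substituting vectors [x_i] of l_1 for [e_i] (after splitting each [x_i]
    into its positive and negative parts and normalising) bounds [pis_norm] by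
    [kappa * pi_norm] on symmetric tensors. Substituting point masses at the coordinates of
    an exchangeable [X] and integrating over the law [mu] of [X] gives
    [mu = \sum_k b_k E (\sum_i y_k(i) delta_(X_i))^n], hence the signed measure [lambda].

    The infimum defining [pis_norm] in finite dimension is attained: by Caratheodory's
    argument the number of terms is bounded by the dimension, and then the parameters
    range over a compact set. The same compactness gives a nearest point in the set of
    tensors of cost at most [r], hence a separating linear form for a tensor outside it;
    integrating this form against [lambda] proves that [||lambda||] is at least the norm of
    the tensor of atoms. The bounds on [kappa] are AM-GM and the polarisation formula. *)

Require Import Defs.
From HB Require Import structures.
From mathcomp Require Import all_boot all_order all_algebra all_fingroup.
From mathcomp Require Import all_classical all_reals all_analysis.
From mathcomp Require Import measurable_realfun ring lra.

Set Implicit Arguments.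
Unset Strict Implicit.
Unset Printing Implicit Defensive.

Import Order.TTheory GRing.Theory Num.Theory.
Import numFieldNormedType.Exports.
Local Open Scope classical_set_scope.
Local Open Scope ring_scope.

(** * The positive projective norm *)

Section sgn_part.
Context {R : realType} {I : Type}.
Implicit Types (x : I -> R).

(** The positive part for [true], the negative part for [false]. The boolean index allows a product
    over [i] of such differences to be expanded by [bigA_distr_bigA] into a sum over sign
    patterns. *)
Definition sgn_part (b : bool) x : I -> R := fun i => Num.max (if b then x i else - x i) 0.

Lemma sgn_part_ge0 b x i : 0 <= sgn_part b x i.
Proof. by rewrite /sgn_part le_max lexx orbT. Qed.

Lemma sgn_partE x i :
  x i = sgn_part true x i - sgn_part false x i /\
  `|x i| = sgn_part true x i + sgn_part false x i.
Proof.
rewrite /sgn_part /=; case/orP: (le_total 0 (x i)) => h.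
  by rewrite max_l// max_r ?subr0 ?addr0 ?oppr_le0// ger0_norm.
by rewrite max_r// max_l ?oppr_ge0// opprK !add0r ler0_norm.
Qed.

End sgn_part.

Section l1norm_theory.
Context {R : realType} {I : choiceType}.
Implicit Types (x : I -> R) (c : R).
Local Notation nrm x := (fine (l1norm x)).

Lemma l1norm_ge0 x : (0 <= l1norm x)%E.
Proof. by apply: esum_ge0 => i _; rewrite lee_fin. Qed.

Lemma l1normK x : in_l1 x -> l1norm x = (nrm x)%:E.
Proof. by move=> xl; rewrite fineK// ge0_fin_numE ?l1norm_ge0. Qed.

Lemma fine_l1norm_ge0 x : 0 <= nrm x.
Proof. by rewrite fine_ge0// l1norm_ge0. Qed.

Lemma l1norm_le x c : (l1norm x <= c%:E)%E -> in_l1 x /\ nrm x <= c.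
Proof.
move=> xc; have xl : in_l1 x by rewrite /in_l1 (le_lt_trans xc)// ltry.
by split=> //; rewrite -lee_fin -l1normK.
Qed.

Lemma norm_le_l1norm x i : in_l1 x -> `|x i| <= nrm x.
Proof.
move=> xl; rewrite -lee_fin -l1normK//; apply: esum_ge.
by exists [set i]; [split=> //; exact: finite_set1|rewrite fsbig_set1].
Qed.

Lemma l1normZ_le c x : (l1norm (fun i => (c * x i)%R) <= `|c|%:E * l1norm x)%E.
Proof.
apply: ge_ereal_sup => _ [A [fA _] <-].
rewrite (eq_fsbigr (fun i => `|c|%:E * `|x i|%:E)%E); last first.
  by move=> i _; rewrite normrM EFinM.
rewrite -ge0_mule_fsumr; last by move=> i; rewrite lee_fin.
by apply: lee_wpmul2l; [rewrite lee_fin|apply: esum_ge; exists A].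
Qed.

Lemma l1norm_comb (J : finType) (c : J -> R) (x : J -> I -> R) :
  (forall j, in_l1 (x j)) ->
  in_l1 (fun i => \sum_j c j * x j i) /\
  nrm (fun i => \sum_j c j * x j i) <= \sum_j `|c j| * nrm (x j).
Proof.
move=> xl; apply: l1norm_le.
apply: (@le_trans _ _ (\sum_j l1norm (fun i => (c j * x j i)%R))%E).
  rewrite /l1norm -esum_sum; last by move=> *; rewrite lee_fin.
  by apply: le_esum => i _; rewrite sumEFin lee_fin ler_norm_sum.
rewrite -sumEFin; apply: lee_sum => j _.
by rewrite (le_trans (l1normZ_le _ _))// EFinM -l1normK.
Qed.

(** Since [|x i|] is the sum of the two parts at [i], splitting a vector by sign costs nothing in
    norm. *)
Lemma l1norm_sgn_part x : in_l1 x ->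
  (forall b, in_l1 (sgn_part b x)) /\ \sum_(b : bool) nrm (sgn_part b x) = nrm x.
Proof.
move=> xl.
have e : (l1norm x = l1norm (sgn_part true x) + l1norm (sgn_part false x))%E.
  rewrite /l1norm -esumD; try by move=> i _; rewrite lee_fin.
  apply: eq_esum => i _; rewrite -EFinD; congr EFin.
  by rewrite !(ger0_norm (sgn_part_ge0 _ _ _)) (sgn_partE x i).2.
have h b : in_l1 (sgn_part b x).
  rewrite /in_l1 (le_lt_trans _ xl)// e.
  by case: b; [rewrite leeDl|rewrite leeDr]; rewrite ?l1norm_ge0.
by split=> //; rewrite big_bool /=; apply: EFin_inj; rewrite EFinD -!l1normK.
Qed.

End l1norm_theory.

Section l1norm_fin.
Context {R : realType}.

Lemma l1norm_ord m (x : 'I_m -> R) : l1norm x = (\sum_i `|x i|)%:E.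
Proof.
have fT : finite_set [set: 'I_m] by exact: finite_finset.
rewrite /l1norm esum_fset//.
rewrite fsbig_finite//= -sumEFin; apply: perm_big; apply: uniq_perm;
  [exact: finmap.fset_uniq|exact: index_enum_uniq|].
by move=> i; rewrite mem_index_enum in_fset_set// in_setT.
Qed.

Lemma in_l1_ord m (x : 'I_m -> R) : in_l1 x.
Proof. by rewrite /in_l1 l1norm_ord ltry. Qed.

Lemma l1norm_ord_comp (I : choiceType) m (h : 'I_m -> I) (x : I -> R) : injective h ->
  (l1norm (x \o h) <= l1norm x)%E.
Proof.
move=> hi; rewrite {1}/l1norm -(esum_image setT h (fun i => `|x i|%:E)); last first.
  by move=> a b _ _ /hi.
rewrite (esum_mkcond (h @` setT)); apply: le_esum => i _.
by case: ifP.
Qed.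

End l1norm_fin.

Section positive_representations.
Context {R : realType} {I : choiceType} {n : nat}.
Implicit Types (t : tensor R I n).
Local Notation nrm x := (fine (l1norm x)).

(* [t] has a representation by powers of positive vectors of cost at most [v]; unlike
   the infimum [pis_norm], this is additive without any epsilon. *)
Definition prep t (v : R) := exists k (a : 'I_k -> R) (x : 'I_k -> I -> R),
  [/\ (forall l, in_l1 (x l) /\ vpos (x l)), t = tcomb a (fun l _ => x l) &
      \sum_(l < k) `|a l| * nrm (x l) ^+ n <= v].

Lemma prep_ge0 t v : prep t v -> 0 <= v.
Proof.
move=> [k [a [x [_ _]]]]; apply: le_trans; apply: sumr_ge0 => l _.
by rewrite mulr_ge0// exprn_ge0// fine_l1norm_ge0.
Qed.

Lemma prep_le t v w : prep t v -> v <= w -> prep t w.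
Proof. by move=> [k [a [x [h1 h2 h3]]]] vw; exists k, a, x; split=> //; exact: le_trans vw. Qed.

Lemma prep_ext t t' v : prep t v -> t =1 t' -> prep t' v.
Proof. by move=> h /funext <-. Qed.

Lemma prep_fin (J : finType) (a : J -> R) (x : J -> I -> R) :
  (forall l, in_l1 (x l) /\ vpos (x l)) ->
  prep (fun j => \sum_l a l * \prod_i x l (j i)) (\sum_l `|a l| * nrm (x l) ^+ n).
Proof.
move=> h; exists #|J|, (fun l => a (enum_val l)), (fun l => x (enum_val l)); split.
- by move=> l; exact: h.
- apply/funext => j; rewrite /tcomb /elem_tensor.
  by rewrite -(big_enum_val (fun l : J => a l * \prod_i x l (j i))).
- by rewrite -(big_enum_val (fun l : J => `|a l| * nrm (x l) ^+ n)).
Qed.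

Lemma prep0 : prep (fun _ => 0) 0.
Proof.
exists 0, (fun _ => 0), (fun _ _ => 0); split; [by case| |by rewrite big_ord0].
by apply/funext => j; rewrite /tcomb big_ord0.
Qed.

Lemma prepZ c t v : prep t v -> prep (fun j => c * t j) (`|c| * v).
Proof.
move=> [k [a [x [h1 -> h3]]]]; exists k, (fun l => c * a l), x; split=> //.
  by apply/funext => j; rewrite /tcomb mulr_sumr; apply: eq_bigr => l _; rewrite mulrA.
under eq_bigr do rewrite normrM -mulrA.
by rewrite -mulr_sumr ler_wpM2l.
Qed.

Lemma prepD t1 t2 v1 v2 : prep t1 v1 -> prep t2 v2 -> prep (fun j => t1 j + t2 j) (v1 + v2).
Proof.
move=> [k1 [a1 [x1 [h11 -> h13]]]] [k2 [a2 [x2 [h21 -> h23]]]].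
pose a l := match l with inl l => a1 l | inr l => a2 l end.
pose x l := match l with inl l => x1 l | inr l => x2 l end.
have /(@prep_fin ('I_k1 + 'I_k2)%type a) : forall l, in_l1 (x l) /\ vpos (x l) by case.
rewrite big_sumType /= => h; apply: prep_le (lerD h13 h23).
by apply: prep_ext h _ => j; rewrite big_sumType.
Qed.

Lemma prep_sum (J : finType) (c : J -> R) (t : J -> tensor R I n) (v : J -> R) :
  (forall l, prep (t l) (v l)) ->
  prep (fun j => \sum_l c l * t l j) (\sum_l `|c l| * v l).
Proof.
move=> h; elim: (index_enum J) => [|l s ih].
  by rewrite big_nil; apply: prep_ext prep0 _ => j; rewrite big_nil.
rewrite big_cons; apply: prep_ext (prepD (prepZ (c l) (h l)) ih) _ => j.
by rewrite big_cons.
Qed.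

Lemma pis_norm_le t v : prep t v -> (pis_norm t <= v%:E)%E.
Proof.
move=> [k [a [x [h1 h2 h3]]]]; apply: (@le_trans _ _ (\sum_(l < k) `|a l| * nrm (x l) ^+ n)%:E).
  by apply: ereal_inf_lbound; exists k, a, x.
by rewrite lee_fin.
Qed.

Lemma pis_norm_lt_prep t v : (pis_norm t < v%:E)%E -> prep t v.
Proof.
move=> /ereal_inf_lt[_ [k [a [x [h1 h2 ->]]]]]; rewrite lte_fin => h3.
by exists k, a, x; split=> //; exact: ltW.
Qed.

Lemma pis_norm_ge0 t : (0 <= pis_norm t)%E.
Proof.
apply: le_ereal_inf_tmp => _ [k [a [x [_ _ ->]]]]; rewrite lee_fin; apply: sumr_ge0 => l _.
by rewrite mulr_ge0// exprn_ge0// fine_l1norm_ge0.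
Qed.

Lemma norm_tcomb_le k (a : 'I_k -> R) (x : 'I_k -> 'I_n -> I -> R) j :
  (forall l i, in_l1 (x l i)) ->
  `|tcomb a x j| <= \sum_(l < k) `|a l| * \prod_(i < n) nrm (x l i).
Proof.
move=> h; apply: le_trans (ler_norm_sum _ _ _) _; apply: ler_sum => l _.
rewrite normrM ler_wpM2l// normr_prod; apply: ler_prod => i _.
by rewrite normr_ge0/= norm_le_l1norm.
Qed.

Lemma prep_norm_le t v j : prep t v -> `|t j| <= v.
Proof.
move=> [k [a [x [h1 -> h3]]]]; apply: le_trans h3.
apply: le_trans; first by apply: norm_tcomb_le => l _; exact: (h1 l).1.
by apply: ler_sum => l _; rewrite prodr_const card_ord.
Qed.

Lemma pi_norm_ge t j : (`|t j|%:E <= pi_norm t)%E.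
Proof.
apply: le_ereal_inf_tmp => _ [k [a [x [h -> ->]]]]; rewrite lee_fin.
exact: norm_tcomb_le.
Qed.

Lemma pi_norm_fin t : is_tensor t -> pi_norm t \is a fin_num.
Proof.
move=> [k [a [x [h e]]]]; rewrite fin_numElt; apply/andP; split.
  have : (0 <= pi_norm t)%E; last by apply: lt_le_trans; exact: ltNyr.
  apply: le_ereal_inf_tmp => _ [k' [a' [x' [_ _ ->]]]]; rewrite lee_fin sumr_ge0// => l _.
  by rewrite mulr_ge0// prodr_ge0// => i _; exact: fine_l1norm_ge0.
apply: (@le_lt_trans _ _ (\sum_(l < k) `|a l| * \prod_(i < n) nrm (x l i))%:E); last exact: ltry.
by apply: ereal_inf_lbound; exists k, a, x.
Qed.

Lemma pi_norm_gt0 t : is_tensor t -> t <> (fun _ => 0) -> 0 < fine (pi_norm t).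
Proof.
move=> tt t0; have [j tj] : exists j, t j != 0.
  apply: contrapT => h; apply: t0; apply/funext => j.
  by apply: contrapT => /eqP tj; apply: h; exists j.
by rewrite (@lt_le_trans _ _ `|t j|) ?normr_gt0// -lee_fin fineK ?pi_norm_fin// pi_norm_ge.
Qed.

(* The symmetric tensor [x_1 \/ ... \/ x_n]. *)
Definition symt (x : 'I_n -> I -> R) : tensor R I n :=
  fun j => (n`!%:R)^-1 * \sum_(s : 'S_n) \prod_i x i (j (s i)).

(** A symmetric [t] is the average of its permuted copies, and averaging turns each elementary
    tensor into its symmetrisation. *)
Lemma is_sym_symt t k (a : 'I_k -> R) (x : 'I_k -> 'I_n -> I -> R) :
  Defs.is_sym t -> t = tcomb a x -> t = fun j => \sum_l a l * symt (x l) j.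
Proof.
move=> ts te; apply/funext => j.
have -> : t j = (n`!%:R)^-1 * \sum_(s : 'S_n) t (fun i => j (s i)).
  rewrite (eq_bigr (fun _ => t j)); last by move=> s _; rewrite {2}(ts s).
  rewrite sumr_const card_Sn.
  by rewrite -[t j *+ _]mulr_natl mulKf// pnatr_eq0 -lt0n fact_gt0.
rewrite te /tcomb exchange_big mulr_sumr; apply: eq_bigr => l _.
by rewrite -mulr_sumr /symt mulrCA.
Qed.

End positive_representations.

(** * The tensor [e_1 \/ ... \/ e_n] and the bounds on its norm *)

Section sym_basis_theory.
Context {R : realType} {n : nat}.

(** [sym_basis] is [1/n!] on permutations and zero elsewhere, so pairing with it averages over
    permutations. It serves both when vectors and when coordinates of a random vector are
    substituted for the [e_i]. *)
Lemma sum_sym_basis (G : ('I_n -> 'I_n) -> R) :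
  \sum_(f : {ffun 'I_n -> 'I_n}) sym_basis R f * G f =
  (n`!%:R)^-1 * \sum_(s : 'S_n) G s.
Proof.
rewrite /sym_basis; under eq_bigr do rewrite -mulrA mulr_suml.
rewrite -mulr_sumr exchange_big; congr (_ * _); apply: eq_bigr => s _.
rewrite (bigD1 [ffun i => s i])//= [X in _ + X]big1 ?addr0; last first.
  move=> f fs; have [i fi] : exists i, f i != s i.
    apply/existsP; rewrite -negb_forall; apply: contra fs => /forallP fs.
    by apply/eqP/ffunP => i; rewrite ffunE; exact/eqP.
  by rewrite /elem_tensor (bigD1 i)//= /basis_vec (negbTE fi) !mul0r.
rewrite /elem_tensor big1 ?mul1r; last by move=> i _; rewrite /basis_vec ffunE eqxx.
by congr G; apply/funext => i; rewrite ffunE.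
Qed.

Lemma sym_basis_id : sym_basis R (id : 'I_n -> 'I_n) = (n`!%:R)^-1.
Proof.
rewrite /sym_basis (bigD1 1%g)//= [X in _ + X]big1 ?addr0; last first.
  move=> s s1; have [i si] : exists i, i != s i.
    apply/existsP; rewrite -negb_forall; apply: contra s1 => /forallP fs.
    by apply/eqP/permP => i; rewrite perm1; apply/esym/eqP.
  by rewrite /elem_tensor (bigD1 i)//= /basis_vec (negbTE si) !mul0r.
rewrite /elem_tensor big1 ?mulr1// => i _.
by rewrite /basis_vec perm1 eqxx.
Qed.

End sym_basis_theory.

Section kappa_bounds.
Context {R : realType}.
Local Notation nrm x := (fine (l1norm x)).

(** Both sides are compared at the multi-index [id], where [sym_basis] is [1/n!]; AM-GM bounds each
    [\prod_i y l i] by [(nrm (y l) / n)^n]. *)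
Lemma sym_basis_lower n v : (0 < n)%N -> prep (@sym_basis R n) v ->
  (n ^ n)%:R / n`!%:R <= v.
Proof.
move=> n0 [k [b [y [h1 h2 h3]]]]; apply: le_trans h3.
have := sym_basis_id (R := R) (n := n); rewrite h2 /tcomb => <-.
rewrite mulr_sumr; apply: ler_sum => l _; rewrite mulrCA.
apply: le_trans (ler_norm _) _; rewrite normrM ler_wpM2l//.
have yE : nrm (y l) = \sum_i y l i.
  rewrite l1norm_ord/=; apply: eq_bigr => i _.
  by rewrite ger0_norm// (h1 l).2.
have [le_AGM _] := @leif_AGM R 'I_n 'I_n (y l) (fun i _ => (h1 l).2 i).
rewrite ger0_norm; last first.
  by rewrite mulr_ge0// prodr_ge0// => i _; exact: (h1 l).2.
rewrite yE; move: le_AGM; rewrite card_ord expr_div_n ler_pdivlMr; last first.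
  by rewrite exprn_gt0// ltr0n.
by rewrite natrX mulrC.
Qed.

(* Polarisation: [n! e_1 \/ ... \/ e_n = \sum_A (-1)^(n - |A|) (\sum_(i in A) e_i)^n]. *)
Lemma sym_basis_upper n : (0 < n)%N ->
  prep (@sym_basis R n) ((2 ^ (n - 1) * n ^ n)%:R / n`!%:R).
Proof.
move=> n0.
pose a (A : {set 'I_n}) : R := (n`!%:R)^-1 * (-1) ^+ #|~: A|.
pose x (A : {set 'I_n}) (i : 'I_n) : R := (i \in A)%:R.
have hx A : in_l1 (x A) /\ vpos (x A).
  by split; [exact: in_l1_ord|move=> i; rewrite /x ler0n].
have nx A : nrm (x A) = #|A|%:R.
  rewrite l1norm_ord/= -sum1_card natr_sum [RHS]big_mkcond; apply: eq_bigr => i _.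
  by rewrite /x; case: (i \in A); rewrite ?normr1 ?normr0.
apply: prep_ext (prep_le (prep_fin a hx) _) _.
  have -> : \sum_A `|a A| * nrm (x A) ^+ n = (\sum_(A : {set 'I_n}) #|A| ^ n)%N%:R / n`!%:R.
    rewrite natr_sum mulr_suml; apply: eq_bigr => A _.
    by rewrite nx normrM normrX normrN1 expr1n mulr1 natrX mulrC ger0_norm.
  rewrite ler_wpM2r// ler_nat.
  (* Pairing each [A] with its complement gives the mean size [n/2]; together with
     [|A|^n <= |A| n^(n-1)] this produces the factor [2^(n-1)]. *)
  have h2 : (2 * \sum_(A : {set 'I_n}) #|A| = n * 2 ^ n)%N.
    rewrite mul2n -addnn {2}(reindex_inj (@finset.setC_inj 'I_n)) -big_split/=.
    under eq_bigr do rewrite cardsC card_ord.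
    by rewrite sum_nat_const -cardsT -finset.powersetT card_powerset cardsT card_ord mulnC.
  have h3 : (\sum_(A : {set 'I_n}) #|A| ^ n <= (\sum_(A : {set 'I_n}) #|A|) * n ^ n.-1)%N.
    rewrite big_distrl; apply: leq_sum => A _.
    have -> : (#|A| ^ n = #|A| * #|A| ^ n.-1)%N by rewrite -expnS prednK.
    rewrite leq_mul2l; apply/orP; right.
    have := max_card A; rewrite card_ord.
    by case: (n.-1)%N => // e; rewrite leq_exp2r.
  rewrite (leq_trans h3)// -(leq_pmul2l (ltn0Sn 1)) mulnA h2.
  have -> : (n ^ n = n * n ^ n.-1)%N by rewrite -expnS prednK.
  have -> : (2 ^ n = 2 * 2 ^ (n - 1))%N by rewrite -expnS subn1 prednK.
  by rewrite mulnCA -!mulnA (mulnCA n).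
move=> j; rewrite /sym_basis; under eq_bigr do rewrite -mulrA.
rewrite -mulr_sumr; congr (_ * _).
(* The entry at [j] of the power of an indicator vector tells whether [A] contains the image of [j].
   If [j] is onto, only the full set contributes; otherwise the terms cancel in pairs. *)
have xE A : \prod_i x A (j i) = (if j @: [set: 'I_n]%SET \subset A then 1 else 0).
  case: ifPn => [/fintype.subsetP jA|].
    by apply: big1 => i _; rewrite /x jA ?imset_f ?finset.in_setT.
  move=> /subsetPn[_ /imsetP[i _ ->] ji]; rewrite (bigD1 i)//= /x (negbTE ji).
  by rewrite mul0r.
under eq_bigr do rewrite xE.
have [jT|] := boolP (j @: [set: 'I_n]%SET == [set: 'I_n]%SET).
  rewrite (eqP jT) (bigD1 [set: 'I_n]%SET)//= subxx finset.setCT cards0 mulr1.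
  rewrite big1 ?addr0; last first.
    by move=> A; rewrite -finset.subTset => /negbTE ->; rewrite mulr0.
  have ji : injective j.
    move=> i1 i2.
    have /imset_injP h : #|j @: [set: 'I_n]%SET| == #|[set: 'I_n]%SET| by rewrite (eqP jT).
    by apply: h; rewrite inE.
  rewrite (bigD1 (perm ji))//= big1 ?addr0; last first.
    move=> s sj; have [i si] : exists i, j i != s i.
      apply/existsP; rewrite -negb_forall; apply: contra sj => /forallP fs.
      by apply/eqP/permP => i; rewrite permE; apply/esym/eqP.
    by rewrite /elem_tensor (bigD1 i)//= /basis_vec (negbTE si) !mul0r.
  by rewrite /elem_tensor big1// => i _; rewrite /basis_vec permE eqxx.
rewrite -finset.subTset => /subsetPn[k _ kj]; rewrite [RHS]big1; last first.
  move=> s _; rewrite /elem_tensor (bigD1 ((s^-1)%g k))//= /basis_vec permKV.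
  by case: eqP => [e|]; rewrite ?mul0r//; case/negP: kj; rewrite -e imset_f.
(* Toggling the membership of [k] in [A] flips the sign. *)
rewrite (bigID (fun A : {set 'I_n} => k \in A))/=.
rewrite (reindex_onto (fun A : {set 'I_n} => k |: A) (fun A : {set 'I_n} => A :\ k))/=; last first.
  by move=> A kA; rewrite finset.setD1K.
rewrite (eq_bigl (fun A : {set 'I_n} => k \notin A)); last first.
  move=> A; rewrite finset.setU11/=; apply/eqP/idP => [<-|kA]; first by rewrite finset.setD11.
  by rewrite finset.setU1K.
rewrite -big_split big1// => A kA /=.
have -> : #|~: A| = #|~: (k |: A)|.+1.
  rewrite (cardsD1 k (~: A)) inE kA add1n; congr _.+1.
  by apply: eq_card => i; rewrite !inE negb_or.
have -> : (j @: [set: 'I_n]%SET \subset k |: A) = (j @: [set: 'I_n]%SET \subset A).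
  apply/fintype.subsetP/fintype.subsetP => h i ij; have := h i ij; rewrite !inE.
    by case: eqP => //= e; case/negP: kj; rewrite -e.
  by move=> ->; rewrite orbT.
by rewrite exprS mulN1r mulNr subrr.
Qed.

End kappa_bounds.

(** * Comparison of the positive norm with the projective norm *)

Section comparison.
Context {R : realType} {I : choiceType} {n : nat}.
Implicit Types (t : tensor R I n) (x : 'I_n -> I -> R).
Local Notation nrm x := (fine (l1norm x)).

(* Substituting positive unit vectors for the basis vectors in a representation
   of [e_1 \/ ... \/ e_n] does not increase its cost. *)
Lemma prep_symt_unit v x : prep (@sym_basis R n) v ->
  (forall i, [/\ in_l1 (x i), vpos (x i) & nrm (x i) <= 1]) -> prep (symt x) v.
Proof.
move=> [k [b [y [h1 h2 h3]]]] hx.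
pose z l : I -> R := fun p => \sum_i y l i * x i p.
have zl l := l1norm_comb (y l) (fun i => let: And3 h _ _ := hx i in h).
have hz l : in_l1 (z l) /\ vpos (z l).
  split=> [|p]; first exact: (zl l).1.
  by apply: sumr_ge0 => i _; rewrite mulr_ge0//; [exact: (h1 l).2|case: (hx i) => _ + _; exact].
apply: prep_ext (prep_le (prep_fin b hz) _) _.
  apply: le_trans h3; apply: ler_sum => l _; rewrite ler_wpM2l// lerXn2r//;
    rewrite ?nnegrE ?fine_l1norm_ge0//.
  apply: le_trans (zl l).2 _; rewrite l1norm_ord/=; apply: ler_sum => i _.
  by rewrite ler_piMr//; case: (hx i).
move=> j; rewrite /symt.
(* Passing to the inverse permutation moves [s] from the multi-index to the vectors, the form in
   which [sum_sym_basis] applies. *)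
have -> : \sum_(s : 'S_n) \prod_i x i (j (s i)) = \sum_(s : 'S_n) \prod_p x (s p) (j p).
  rewrite (reindex_inj invg_inj); apply: eq_bigr => s _.
  by rewrite (reindex_inj (@perm_inj _ s)); apply: eq_bigr => i _; rewrite permK.
rewrite -(sum_sym_basis (fun f => \prod_p x (f p) (j p))) h2.
under eq_bigr do rewrite bigA_distr_bigA mulr_sumr.
rewrite exchange_big; apply: eq_bigr => f _; rewrite /tcomb mulr_suml.
by apply: eq_bigr => l _; rewrite big_split mulrA.
Qed.

(** By homogeneity each [x i] may be divided by its norm. A vector of norm zero vanishes, and then
    [y i] is zero as well, still of norm at most 1. *)
Lemma prep_symt_pos v x : prep (@sym_basis R n) v ->
  (forall i, in_l1 (x i) /\ vpos (x i)) -> prep (symt x) (v * \prod_i nrm (x i)).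
Proof.
move=> hv hx.
pose y i p := (nrm (x i))^-1 * x i p.
have xE i p : x i p = nrm (x i) * y i p.
  rewrite /y; have [e|ne] := eqVneq (nrm (x i)) 0; last by rewrite mulVKf.
  apply/eqP; rewrite e mul0r -normr_le0 -e; exact/norm_le_l1norm/(hx i).1.
have := prepZ (\prod_i nrm (x i)) (prep_symt_unit hv (x := y) _).
rewrite ger0_norm; last by apply: prodr_ge0 => i _; exact: fine_l1norm_ge0.
rewrite mulrC => h; apply: prep_ext (h _) _ => [i|j]; last first.
  rewrite /symt mulrCA mulr_sumr; congr (_ * _); apply: eq_bigr => s _.
  by rewrite -big_split; apply: eq_bigr => i _; rewrite [RHS]xE.
have le1 : (l1norm (y i) <= 1%:E)%E.
  apply: le_trans (l1normZ_le _ _) _; rewrite (l1normK (hx i).1) -EFinM lee_fin.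
  rewrite ger0_norm ?invr_ge0 ?fine_l1norm_ge0//.
  by have [->|ne] := eqVneq (nrm (x i)) 0; rewrite ?mulr0 ?mulVf.
have [l1 n1] := l1norm_le le1; split=> // p.
by rewrite mulr_ge0 ?invr_ge0 ?fine_l1norm_ge0//; exact: (hx i).2.
Qed.

(** Expanding each [x i] as positive minus negative part gives [2^n] signed terms, whose norm
    products sum back to [\prod_i nrm (x i)], so no constant is lost. *)
Lemma prep_symt v x : prep (@sym_basis R n) v ->
  (forall i, in_l1 (x i)) -> prep (symt x) (v * \prod_i nrm (x i)).
Proof.
move=> hv hx.
pose c (e : {ffun 'I_n -> bool}) : R := \prod_i (if e i then 1 else -1).
pose y (e : {ffun 'I_n -> bool}) i := sgn_part (e i) (x i).
have hy e i : in_l1 (y e i) /\ vpos (y e i).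
  by split; [exact: (l1norm_sgn_part (hx i)).1|exact: sgn_part_ge0].
apply: prep_ext (prep_le (prep_sum c (fun e => prep_symt_pos hv (hy e))) _) _.
  rewrite (eq_bigr (fun e => v * \prod_i nrm (y e i))); last first.
    move=> e _; rewrite normr_prod big1 ?mul1r// => i _.
    by case: (e i); rewrite ?normrN1 ?normr1.
  rewrite -mulr_sumr -(bigA_distr_bigA (fun i b => nrm (sgn_part b (x i)))).
  by rewrite (eq_bigr _ (fun i _ => (l1norm_sgn_part (hx i)).2)).
move=> j; rewrite /symt; under eq_bigr => e _ do rewrite mulrCA mulr_sumr.
rewrite -mulr_sumr exchange_big; congr (_ * _); apply: eq_bigr => s _.
have xE i : x i (j (s i)) = \sum_(b : bool) (if b then 1 else -1) * sgn_part b (x i) (j (s i)).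
  by rewrite big_bool /= mul1r mulN1r; exact: (sgn_partE _ _).1.
rewrite [RHS](eq_bigr _ (fun i _ => xE i)).
rewrite (bigA_distr_bigA (fun i b => (if b then 1 else -1) * sgn_part b (x i) (j (s i)))).
by apply: eq_bigr => e _; rewrite big_split.
Qed.

(** In any projective representation of [t], each elementary tensor is symmetrised and then replaced
    by a positive representation, which multiplies its cost by [v]. *)
Lemma pis_norm_le_pi v t : 0 < v -> prep (@sym_basis R n) v -> Defs.is_sym t ->
  (pis_norm t <= v%:E * pi_norm t)%E.
Proof.
move=> v0 hv ts; rewrite -lee_pdivrMl//; apply: le_ereal_inf_tmp => _ [k [a [x [h e ->]]]].
rewrite lee_pdivrMl// -EFinM; apply: pis_norm_le.
rewrite (is_sym_symt ts e) mulr_sumr.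
under eq_bigr do rewrite mulrCA.
by apply: prep_sum => l; exact: prep_symt.
Qed.

Lemma c_pis_le v : 0 < v -> prep (@sym_basis R n) v -> (c_pis R I n <= v%:E)%E.
Proof.
move=> v0 hv; apply: ge_ereal_sup => _ [t [tt ts t0 ->]].
have p0 := pi_norm_gt0 tt t0.
rewrite muleC lee_pdivrMl// muleC fineK ?pi_norm_fin//.
exact: pis_norm_le_pi.
Qed.

Lemma l1norm_indic (q : I) : l1norm (fun p => (p == q)%:R : R) = 1%E.
Proof.
rewrite /l1norm -[RHS](esum_set1 (t := q) (a := fun=> 1%E))// (esum_mkcond [set q]).
apply: eq_esum => p _; rewrite in_set1; case: eqP => _; first by rewrite normr1.
by rewrite normr0.
Qed.

(** The test tensor is the copy of [sym_basis] carried by the [n] coordinates in the range of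
    [h]. *)
Lemma kappa_le_c_pis (h : 'I_n -> I) : injective h -> (kappa R n <= c_pis R I n)%E.
Proof.
move=> hi; pose x i : I -> R := fun p => (p == h i)%:R.
have nx i : l1norm (x i) = 1%E by exact: l1norm_indic.
have xl i : in_l1 (x i) by rewrite /in_l1 nx ltry.
have te : symt x = tcomb (fun _ : 'I_#|{perm 'I_n}| => (n`!%:R)^-1)
                    (fun l i => x ((enum_val l : 'S_n) i)).
  apply/funext => j; rewrite /symt /tcomb /elem_tensor -mulr_sumr; congr (_ * _).
  rewrite -(big_enum_val (fun s : 'S_n => \prod_i x (s i) (j i))) (reindex_inj invg_inj).
  apply: eq_bigr => s _.
  by rewrite (reindex_inj (@perm_inj _ s)); apply: eq_bigr => i _; rewrite permK.
have tt : is_tensor (symt x) by do 3 eexists; split; [|exact: te].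
have ts : Defs.is_sym (symt x).
  move=> s; apply/funext => j; rewrite /symt (reindex_inj (mulIg s)); congr (_ * _).
  by apply: eq_bigr => u _; apply: eq_bigr => i _; rewrite permM.
have tb j : symt x (h \o j) = sym_basis R j.
  rewrite /symt /sym_basis (reindex_inj invg_inj); congr (_ * _); apply: eq_bigr => s _.
  rewrite (reindex_inj (@perm_inj _ s)) /elem_tensor; apply: eq_bigr => i _.
  by rewrite permK /x /basis_vec /= (inj_eq hi); case: eqP.
have t0 : symt x <> (fun _ => 0).
  move=> /(congr1 (fun f => f (h \o id))); rewrite tb sym_basis_id => /eqP.
  by rewrite invr_eq0 pnatr_eq0 -leqn0 leqNgt fact_gt0.
(* The [n!] terms of weight [1/n!] in unit vectors bound the projective norm by 1, so the quotient
   in [c_pis] is at least the positive norm. *)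
have p1 : fine (pi_norm (symt x)) <= 1.
  rewrite -lee_fin fineK ?pi_norm_fin//; apply: ereal_inf_lbound.
  do 3 eexists; split; [|exact: te|]; first by move=> *; exact: xl.
  congr EFin; under eq_bigr => l _.
    rewrite big1 ?mulr1; last by move=> i _; rewrite nx.
    rewrite ger0_norm//; over.
  by rewrite sumr_const card_ord card_Sn -[_ *+ _]mulr_natl mulfV// pnatr_eq0 -lt0n fact_gt0.
apply: (@le_trans _ _ (pis_norm (symt x) * ((fine (pi_norm (symt x)))^-1)%:E)%E); last first.
  by apply: ereal_sup_ubound; exists (symt x).
apply: (@le_trans _ _ (pis_norm (symt x))); last first.
  rewrite -[leLHS]mule1; apply: lee_wpmul2l; first exact: pis_norm_ge0.
  by rewrite lee_fin invf_ge1// pi_norm_gt0.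
(* Restricting a positive representation to the coordinates [h i] represents [sym_basis];
   injectivity of [h] keeps the norms from growing. *)
apply: le_ereal_inf_tmp => _ [k [a [y [hy e ->]]]].
apply: pis_norm_le; exists k, a, (fun l => y l \o h); split.
- by move=> l; split; [exact: in_l1_ord|move=> i; exact: (hy l).2].
- by apply/funext => j; rewrite -tb e.
- apply: ler_sum => l _; rewrite ler_wpM2l// lerXn2r// ?nnegrE ?fine_l1norm_ge0//.
  by rewrite -lee_fin -!l1normK ?l1norm_ord_comp//; [exact: (hy l).1|exact: in_l1_ord].
Qed.

End comparison.

(** * Attaining the infimum: Caratheodory reduction and compactness *)

Section elimination.
Context {R : realType}.

(* A linear relation [\sum_i c i v_i = 0] lets one move the coefficients along [c] in
   the direction that does not increase [\sum_i |a i|] until one of them vanishes. *)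
Lemma eliminate_coef k (a c : 'I_k -> R) : (forall l, a l != 0) -> (exists l, c l != 0) ->
  exists s l, a l + s * c l = 0 /\ \sum_i `|a i + s * c i| <= \sum_i `|a i|.
Proof.
move=> a0.
(* Up to replacing [c] by [-c], the derivative of [\sum_i |a i|] in the direction [c] is
   nonpositive. *)
wlog D0 : c / \sum_i Num.sg (a i) * c i <= 0 => [wl [l0 cl0]|].
  have [D0|/ltW D0] := leP (\sum_i Num.sg (a i) * c i) 0; first by apply: wl => //; exists l0.
  have [||s [l [e h]]] := wl (fun i => - c i).
  - under eq_bigr do rewrite mulrN; by rewrite sumrN oppr_le0.
  - by exists l0; rewrite oppr_eq0.
  - exists (- s), l; rewrite mulNr -mulrN; split=> //.
    by under eq_bigr do rewrite mulNr -mulrN.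
move=> [l0 cl0].
have [l1 hl1] : exists l, Num.sg (a l) * c l < 0.
  apply: contrapT => h; case/eqP: cl0.
  have h0 i : 0 <= Num.sg (a i) * c i by rewrite leNgt; apply/negP => hi; apply: h; exists i.
  have /eqP : \sum_i Num.sg (a i) * c i = 0 by apply/eqP; rewrite eq_le D0 sumr_ge0.
  rewrite psumr_eq0// => /allP /(_ l0 (mem_index_enum _)) /=.
  by rewrite mulf_eq0 sgr_eq0 (negbTE (a0 l0)) => /eqP.
(* [l] is the first coefficient to reach zero. Up to [s = |a l| / |c l|] none changes sign, so the
   sum of absolute values is affine in [s] with slope at most zero. *)
have [l hl lmin] := arg_minP (fun i => `|a i| / `|c i|) (P := fun l => Num.sg (a l) * c l < 0) hl1.
have cl : c l != 0 by apply: contraTneq hl => ->; rewrite mulr0 ltxx.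
have cg i : Num.sg (a i) * c i < 0 -> Num.sg (a i) * c i = - `|c i|.
  by move=> h; rewrite -[LHS]opprK -(ltr0_norm h) normrM normr_sg a0 mul1r.
pose s := `|a l| / `|c l|.
have s0 : 0 <= s by rewrite divr_ge0.
have sc i : 0 <= `|a i| + s * (Num.sg (a i) * c i).
  have [h|h] := leP 0 (Num.sg (a i) * c i); first by rewrite addr_ge0// mulr_ge0.
  have ci : c i != 0 by apply: contraTneq h => ->; rewrite mulr0 ltxx.
  by rewrite cg// mulrN subr_ge0 -ler_pdivlMr ?normr_gt0//; exact: lmin.
have sE i : `|a i + s * c i| = `|a i| + s * (Num.sg (a i) * c i).
  rewrite -(ger0_norm (sc i)) [`|a i|]normrEsg mulrCA -mulrDr normrM normr_sg a0.
  by rewrite mul1r.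
exists s, l; split.
  apply/eqP; rewrite -normr_eq0 sE cg// mulrN /s divfK ?normr_eq0//.
  by rewrite subrr.
rewrite (eq_bigr _ (fun i _ => sE i)) big_split/= -mulr_sumr gerDl.
by rewrite mulr_ge0_le0.
Qed.

End elimination.

Section simplex_representations.
Context {R : realType} {m n : nat}.
Implicit Types (t : tensor R 'I_m n) (y : 'I_m -> R).
Local Notation nrm x := (fine (l1norm x)).

Definition simplex y := (forall i, 0 <= y i) /\ \sum_i y i = 1.

(* A representation by [k] points of the simplex, of cost at most [r]. *)
Definition srep k t (r : R) := exists (a : 'I_k -> R) (y : 'I_k -> 'I_m -> R),
  [/\ forall l, simplex (y l), t = tcomb a (fun l _ => y l) & \sum_l `|a l| <= r].

Lemma l1norm_simplex y : simplex y -> nrm y = 1.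
Proof.
move=> [y0 y1]; rewrite l1norm_ord/= -[RHS]y1.
by apply: eq_bigr => i _; rewrite ger0_norm.
Qed.

Lemma srep_prep k t r : srep k t r -> prep t r.
Proof.
move=> [a [y [hy te ha]]]; exists k, a, y; split=> //.
  by move=> l; split; [exact: in_l1_ord|exact: (hy l).1].
by under eq_bigr do rewrite l1norm_simplex// expr1n mulr1.
Qed.

Lemma simplex_ord0 (m0 : (0 < m)%N) : simplex (fun i => (i == Ordinal m0)%:R).
Proof.
split=> [i|]; first by rewrite ler0n.
rewrite (bigD1 (Ordinal m0))// eqxx big1 /= ?addr0// => i /negbTE ->.
by [].
Qed.

(** The norms are absorbed into the coefficients. A vector of norm zero contributes nothing because
    [n > 0]; it is replaced by a vertex of the simplex with coefficient zero. *)
Lemma prep_srep t r : (0 < m)%N -> (0 < n)%N -> prep t r -> exists k, srep k t r.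
Proof.
move=> m0 n0 [k [a [x [hx -> ha]]]]; exists k.
exists (fun l => a l * nrm (x l) ^+ n).
exists (fun l => if nrm (x l) == 0 then fun i => (i == Ordinal m0)%:R
                 else fun i => (nrm (x l))^-1 * x l i); split.
- move=> l; case: eqP => [_|/eqP ne]; first exact: simplex_ord0.
  split=> [i|]; first by rewrite mulr_ge0 ?invr_ge0 ?fine_l1norm_ge0//; exact: (hx l).2.
  rewrite -mulr_sumr; have -> : \sum_i x l i = nrm (x l); last by rewrite mulVf.
  by rewrite l1norm_ord/=; apply: eq_bigr => i _; rewrite ger0_norm//; exact: (hx l).2.
- apply/funext => j; rewrite /tcomb /elem_tensor; apply: eq_bigr => l _.
  rewrite -mulrA; congr (_ * _); case: eqP => [e|/eqP ne].
    rewrite e expr0n eqn0Ngt n0 mul0r (bigD1 (Ordinal n0))//=.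
    have := norm_le_l1norm (j (Ordinal n0)) (hx l).1.
    by rewrite e normr_le0 => /eqP ->; rewrite mul0r.
  rewrite big_split/= prodr_const card_ord mulrA -exprMn mulfV//.
  by rewrite expr1n mul1r.
- under eq_bigr do rewrite normrM normrX (ger0_norm (fine_l1norm_ge0 _)).
  exact: ha.
Qed.

Lemma srep_pad k k' t r : (0 < m)%N -> (k <= k')%N -> srep k t r -> srep k' t r.
Proof.
move=> m0 kk' [a [y [hy -> ha]]]; rewrite -(subnKC kk'); move: (k' - k)%N => d {kk'}.
exists (fun l => match fintype.split l with inl l => a l | inr _ => 0 end).
exists (fun l => match fintype.split l with
                 | inl l => y l | inr _ => fun i => (i == Ordinal m0)%:R end).
split.
- by move=> l; case: fintype.split => // _; exact: simplex_ord0.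
- apply/funext => j; rewrite /tcomb big_split_ord/= [X in _ + X]big1 ?addr0; last first.
    by move=> l _; rewrite -/(unsplit (inr l)) unsplitK mul0r.
  by apply: eq_bigr => l _; rewrite -/(unsplit (inl l)) unsplitK.
- rewrite big_split_ord/= [X in _ + X]big1 ?addr0; last first.
    by move=> l _; rewrite -/(unsplit (inr l)) unsplitK normr0.
  rewrite (eq_bigr (fun l => `|a l|))// => l _.
  by rewrite -/(unsplit (inl l)) unsplitK.
Qed.

(** The dimension of the space of tensors. *)
Let N := #|{ffun 'I_n -> 'I_m}|.

Lemma srep_remove k t r (a : 'I_k.+1 -> R) (y : 'I_k.+1 -> 'I_m -> R) l :
  (forall l, simplex (y l)) -> t = tcomb a (fun l _ => y l) -> \sum_l `|a l| <= r ->
  a l = 0 -> srep k t r.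
Proof.
move=> hy -> ha al.
exists (fun i => a (lift l i)), (fun i => y (lift l i)); split=> //.
  by apply/funext => j; rewrite /tcomb (bigD1_ord l)//= al mul0r add0r.
by move: ha; rewrite (bigD1_ord l)//= al normr0 add0r.
Qed.

(** More than [N] tensors in a space of dimension [N] satisfy a linear relation, along which
    [eliminate_coef] annihilates one coefficient. *)
Lemma srep_drop k t r : (N <= k)%N -> srep k.+1 t r -> srep k t r.
Proof.
move=> Nk [a [y [hy te ha]]].
have [/existsP[l /eqP al]|] := boolP [exists l, a l == 0]; first exact: srep_remove hy te ha al.
rewrite negb_exists => /forallP a0.
(* Row [l] lists the entries of the [n]-th tensor power of [y l]; a nonzero vector of the left
   kernel is the linear relation. *)
pose V : 'M[R]_(k.+1, N) := \matrix_(l, f) \prod_i y l ((enum_val f : {ffun 'I_n -> 'I_m}) i).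
have kV : kermx V != 0.
  rewrite -mxrank_eq0 mxrank_ker subn_eq0 -ltnNge.
  by rewrite (leq_ltn_trans (rank_leq_col V)).
have := kV; rewrite -nz_row_eq0; set c := nz_row _ => c0.
have cV : c *m V = 0 by apply/sub_kermxP; exact: nz_row_sub.
have [|s [l [el hs]]] := eliminate_coef (c := fun l => c 0 l) a0.
  by move: c0 => /rV0Pn[l cl]; exists l.
apply: (srep_remove (a := fun i => a i + s * c 0 i) (l := l) hy) => //; last exact: le_trans ha.
rewrite te; apply/funext => j; rewrite /tcomb.
under [RHS]eq_bigr do rewrite mulrDl -mulrA.
rewrite big_split/= -mulr_sumr.
have -> : \sum_l c 0 l * elem_tensor (fun _ => y l) j = 0; last by rewrite mulr0 addr0.
have := congr1 (fun M : 'M[R]_(1, N) => M 0 (enum_rank [ffun i => j i])) cV.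
rewrite /= mxE [RHS]mxE => cVj; rewrite -[RHS]cVj; apply: eq_bigr => i _.
rewrite mxE enum_rankK; congr (_ * _).
by apply: eq_bigr => p _; rewrite ffunE.
Qed.

(** A number of terms independent of [t] and [r] puts all representations into one
    finite-dimensional parameter space. *)
Lemma prepP t r : (0 < m)%N -> (0 < n)%N -> prep t r <-> srep N t r.
Proof.
move=> m0 n0; split; last exact: srep_prep.
move=> /(prep_srep m0 n0)[k hk].
have [kN|Nk] := leqP k N; first exact: srep_pad hk.
move: hk; rewrite -(subnKC (ltnW Nk)); elim: (k - N)%N => [|d ih]; first by rewrite addn0.
by rewrite addnS => /srep_drop h; apply: ih; apply: h; rewrite leq_addr.
Qed.

End simplex_representations.

(** * Nearest points, attainment of the infimum and separation *)

Section nearest_point.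
Context {R : realType} {m n : nat} (m0 : (0 < m)%N) (n0 : (0 < n)%N).
Implicit Types (t c x : tensor R 'I_m n).

Let N := #|{ffun 'I_n -> 'I_m}|.

Definition sqdist t c : R := \sum_(f : {ffun 'I_n -> 'I_m}) (t f - c f) ^+ 2.

Lemma sqdist_ge0 t c : 0 <= sqdist t c.
Proof. by apply: sumr_ge0 => f _; exact: sqr_ge0. Qed.

Lemma sqdist_eq0 t c : sqdist t c = 0 -> t = c.
Proof.
move=> /eqP; rewrite psumr_eq0; last by move=> f _; exact: sqr_ge0.
move=> /allP h; apply/funext => j.
have := h [ffun i => j i] (mem_index_enum _); rewrite /= sqrf_eq0 subr_eq0 => /eqP.
by have -> : ([ffun i => j i] : 'I_n -> 'I_m) = j by apply/funext => i; rewrite ffunE.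
Qed.

(** The tensors of cost at most [r] are the continuous image of a compact set of coefficients and
    simplex points, so the distance to [t] attains its minimum there. *)
Lemma nearest_point t r : 0 <= r ->
  exists c, prep c r /\ forall x, prep x r -> sqdist t c <= sqdist t x.
Proof.
move=> r0.
(* Parameters are indexed by [T]: [(l, None)] holds the [l]-th coefficient and [(l, Some i)] the
   [i]-th coordinate of the [l]-th point. *)
pose T := ('I_N * option 'I_m)%type.
pose X := prod_topology (fun _ : T => (R : topologicalType)).
pose ten (g : X) : tensor R 'I_m n :=
  tcomb (fun l => g (l, None)) (fun l _ i => g (l, Some i)).
have cproj (p : T) : continuous (fun g : X => g p : R) by exact: proj_continuous.
have csum (J : finType) (F : J -> X -> R) :
    (forall j, continuous (F j)) -> continuous (fun g => \sum_j F j g).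
  by move=> h; apply: continuous_big => [|j _]; [exact: add_continuous|exact: h].
have cprod (J : finType) (F : J -> X -> R) :
    (forall j, continuous (F j)) -> continuous (fun g => \prod_j F j g).
  by move=> h; apply: continuous_big => [|j _]; [exact: mul_continuous|exact: h].
have cmul (F G : X -> R) : continuous F -> continuous G -> continuous (fun g => F g * G g).
  by move=> hF hG g; exact: (cvgM (hF g) (hG g)).
have cten j : continuous (fun g => ten g j).
  apply: (csum _ (fun l (g : X) => (g (l, None) : R) * \prod_i (g (l, Some (j i)) : R))) => l.
  apply: (cmul (fun g : X => g (l, None) : R) (fun g : X => \prod_i (g (l, Some (j i)) : R))).
    exact: cproj.
  by apply: (cprod _ (fun i (g : X) => g (l, Some (j i)) : R)) => i; exact: cproj.
pose B : set X :=
  [set g | forall p : T, (if p.2 is Some _ then `[0, 1] else `[- r, r])%classic (g p)].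
have cB : compact B.
  apply: (@tychonoff _ (fun _ : T => (R : topologicalType))
    (fun p : T => if p.2 is Some _ then `[0, 1] else `[- r, r])%classic).
  by move=> [l [i|]] /=; exact: segment_compact.
pose E : set X := \bigcap_(l in [set: 'I_N]) [set g | \sum_i g (l, Some i) = 1].
pose F : set X := [set g | \sum_l `|g (l, None)| <= r].
have cE : closed E.
  apply: closed_bigI => l _.
  apply: (@preimage_closed _ _ (fun g : X => \sum_i g (l, Some i)) [set z | z = 1]).
    by move=> g _; apply: (csum _ (fun i (g : X) => g (l, Some i) : R)) => i; exact: cproj.
  exact: closed_eq.
have cF : closed F.
  apply: (@preimage_closed _ _ (fun g : X => \sum_l `|g (l, None)|) [set z | z <= r]).
    move=> g _; apply: (csum _ (fun l (g : X) => `|g (l, None) : R|)) => l {}g.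
    exact: (cvg_norm (cproj (l, None) g)).
  exact: closed_le.
pose K := B `&` (E `&` F).
have cK : compact K.
  apply: (@subclosed_compact _ _ B) => //; last by move=> g [].
  apply: closedI; last exact: closedI.
  by apply: compact_closed => //; apply: hausdorff_product => p; exact: norm_hausdorff.
have srepK x : srep N x r -> exists2 g, K g & ten g = x.
  move=> [a [y [hy te ha]]].
  exists (fun p => if p.2 is Some i then y p.1 i else a p.1); last by rewrite te.
  split; [|split] => //=.
    move=> [l [i|]] /=; rewrite in_itv/=.
      rewrite (hy l).1/= -(hy l).2 (bigD1 i)//= lerDl sumr_ge0// => k _.
      exact: (hy l).1.
    rewrite -ler_norml (le_trans _ ha)// (bigD1 l)//= lerDl sumr_ge0//.
  by move=> l _; exact: (hy l).2.
have Ksrep g : K g -> srep N (ten g) r.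
  move=> [gB [gE gF]]; exists (fun l => g (l, None)), (fun l i => g (l, Some i)); split=> //.
  move=> l; split; last exact: gE.
  by move=> i; have := gB (l, Some i); rewrite /= in_itv/= => /andP[].
have [||| g gK gmin] := @compact_EVT_min X R (fun g => sqdist t (ten g)) K.
- have /prepP h : prep ((fun _ => 0) : tensor R 'I_m n) r by exact: prep_le prep0 r0.
  by have [g gK _] := srepK _ (h m0 n0); exists g.
- exact: cK.
- apply: continuous_subspaceT.
  apply: (csum {ffun 'I_n -> 'I_m} (fun f g => (t f - ten g f) ^+ 2)) => f.
  have cs : continuous (fun g => t f - ten g f).
    by move=> g; exact: (cvgB (cvg_cst (t f)) (cten f g)).
  exact: (cmul _ _ cs cs).
exists (ten g); split; first by apply: srep_prep; apply: Ksrep; rewrite inE in gK.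
move=> x /prepP - /(_ m0 n0) /srepK[g' g'K <-].
by apply: gmin; rewrite inE.
Qed.

(** A representation of cost [r + e], scaled by [r / (r + e)], has cost at most [r] and moves each
    entry of [t] by at most [e]. For small [e] this beats the nearest point unless that point is
    [t]. *)
Lemma pis_norm_attained t r : (pis_norm t <= r%:E)%E -> prep t r.
Proof.
move=> tr; have r0 : 0 <= r by rewrite -lee_fin (le_trans (pis_norm_ge0 t)).
have [c [cr cmin]] := nearest_point t r0.
rewrite (@sqdist_eq0 t c)//; apply/eqP; rewrite eq_le sqdist_ge0 andbT leNgt; apply/negP => D0.
set D := sqdist t c in cmin D0.
(* This choice ensures both [e <= 1], so that [e^2 <= e], and [N e < D]. *)
pose e := D / (D + N%:R).
have DN : 0 < D + N%:R by rewrite ltr_wpDr.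
have e0 : 0 < e by rewrite divr_gt0.
have e1 : e <= 1 by rewrite ler_pdivrMr// mul1r lerDl.
have eD : N%:R * e < D by rewrite /e mulrA ltr_pdivrMr// mulrC ltr_pM2l// ltrDr.
clearbody e.
have te : prep t (r + e).
  by apply: pis_norm_lt_prep; rewrite (le_lt_trans tr)// lte_fin ltrDl.
have re : 0 < r + e by rewrite ltr_wpDl.
have xr : prep (fun j => r / (r + e) * t j) r.
  have := prepZ (r / (r + e)) te.
  by rewrite ger0_norm ?divfK ?gt_eqF// divr_ge0// ltW.
have /(le_lt_trans (cmin _ xr)) : sqdist t (fun j => r / (r + e) * t j) < D; last by rewrite ltxx.
have le_e2 (f : {ffun 'I_n -> 'I_m}) : (t f - r / (r + e) * t f) ^+ 2 <= e.
  have tE : t f - r / (r + e) * t f = e / (r + e) * t f.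
    by rewrite -{1}[t f]mul1r -mulrBl -{1}(divff (lt0r_neq0 re)) -mulrBl addrC addKr.
  have : `|t f - r / (r + e) * t f| <= e.
    rewrite tE normrM ger0_norm ?divr_ge0 ?(ltW re) ?(ltW e0)//.
    by rewrite mulrAC ler_pdivrMr// ler_wpM2l ?(ltW e0)//; exact: prep_norm_le te.
  move=> h; rewrite -real_normK ?num_real// expr2.
  by apply: le_trans (ler_pM _ _ h h) _ => //; rewrite ler_piMr// ltW.
apply: (@le_lt_trans _ _ (N%:R * e)).
  rewrite mulr_natl -sumr_const; apply: ler_sum => f _; exact: le_e2.
exact: eD.
Qed.

(** The separating form is the inner product with [t - c], where [c] is the nearest point of the
    convex set of tensors of cost at most [r]. *)
Lemma prep_separation t r : 0 <= r -> ~ prep t r ->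
  exists (phi : {ffun 'I_n -> 'I_m} -> R) (b : R),
    (forall x, prep x r -> \sum_f phi f * x f <= b) /\ b < \sum_f phi f * t f.
Proof.
move=> r0 tr; have [c [cr cmin]] := nearest_point t r0.
have D0 : 0 < sqdist t c.
  rewrite lt_def sqdist_ge0 andbT; apply/negP => /eqP/sqdist_eq0 tc.
  by apply: tr; rewrite tc.
exists (fun f => t f - c f), (\sum_(f : {ffun 'I_n -> 'I_m}) (t f - c f) * c f); split; last first.
  rewrite -subr_gt0 -sumrB; under eq_bigr do rewrite -mulrBr.
  by under eq_bigr do rewrite -expr2.
move=> x xr; rewrite -subr_le0 -sumrB; under eq_bigr do rewrite -mulrBr.
set P := \sum_f _; rewrite leNgt; apply/negP => P0.
pose Q := sqdist x c; have Q0 : 0 <= Q by exact: sqdist_ge0.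
have PQ : 0 < P + Q by rewrite ltr_wpDr.
(* Moving from [c] towards [x] by the fraction [s] changes the squared distance by
   [- s (2 P - s Q)]. Minimality forces [2 P <= s Q], whereas [s Q = P Q / (P + Q) < 2 P] when
   [P > 0]. *)
pose s := P / (P + Q).
have s0 : 0 < s by rewrite divr_gt0.
have s1 : s <= 1 by rewrite ler_pdivrMr// mul1r lerDl.
have /cmin : prep (fun j => (1 - s) * c j + s * x j) r.
  have s1' : 0 <= 1 - s by rewrite subr_ge0.
  have := prepD (prepZ (1 - s) cr) (prepZ s xr).
  by rewrite (ger0_norm s1') (ger0_norm (ltW s0)) -mulrDl subrK mul1r.
have -> : sqdist t (fun j => (1 - s) * c j + s * x j) = sqdist t c - s * (2 * P - s * Q).
  rewrite /P /Q /sqdist !mulr_sumr -sumrB mulr_sumr -sumrB; apply: eq_bigr => f _.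
  ring.
rewrite lerBrDr gerDl => h.
have : 2 * P <= s * Q by rewrite -subr_le0 -(pmulr_rle0 _ s0).
by rewrite leNgt /s mulrAC ltr_pdivrMr// mulrDr; nra.
Qed.

End nearest_point.

(** * Product measures and signed measures *)

Section iterated_product.
Context {R : realType} {d : measure_display} {S : measurableType d}.
Local Open Scope ereal_scope.

Lemma iprod_ge0 (nu : probability S R) n (f : n.-tuple S -> \bar R) :
  (forall t, 0 <= f t) -> 0 <= iprod nu f.
Proof.
by elim: n f => [|n ih] f f0 //=; apply: integral_ge0 => x _; exact: ih.
Qed.

Lemma eq_iprod (nu : probability S R) n (f g : n.-tuple S -> \bar R) :
  f =1 g -> iprod nu f = iprod nu g.
Proof. by move=> /funext ->. Qed.

Lemma iprod0 (nu : probability S R) n : iprod nu (fun _ : n.-tuple S => 0) = 0.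
Proof. by elim: n => [|n ih] //=; under eq_integral do rewrite ih; rewrite integral0. Qed.

(** Measure and integrand both depend on a parameter in an arbitrary space, so that in the induction
    the first coordinate can join the parameter and [Y] become [Y * S]. *)
Lemma measurable_iprod n : forall dY (Y : measurableType dY) (p : Y -> pprobability S R),
  measurable_fun [set: Y] p -> forall f : (Y * n.-tuple S)%type -> \bar R,
  (forall z, 0 <= f z) -> measurable_fun setT f ->
  measurable_fun [set: Y] (fun y => iprod (p y) (fun t => f (y, t))).
Proof.
elim: n => [|n ih] dY Y p mp f f0 mf /=.
  apply: (measurableT_comp mf) => /=.
  by apply: measurable_fun_pair => //; exact: measurable_cst.
pose k (z : Y * S) := iprod (p z.1) (fun t => f (z.1, cons_tuple z.2 t)).
apply: (measurable_fun_integral_sfinite_kernel k (kprobability mp)).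
  by move=> z; exact: iprod_ge0.
apply: (ih _ _ (fun z : Y * S => p z.1) _ (fun z => f (z.1.1, cons_tuple z.1.2 z.2))) => //.
  exact: measurableT_comp mp measurable_fst.
apply: (measurableT_comp mf); apply: measurable_fun_pair.
  exact: measurableT_comp measurable_fst measurable_fst.
apply: measurable_cons; last exact: measurable_snd.
exact: measurableT_comp measurable_snd measurable_fst.
Qed.

Lemma nu_pow_ge0 n (nu : probability S R) (A : set (n.-tuple S)) : 0 <= nu_pow nu A.
Proof. by apply: iprod_ge0 => t; rewrite lee_fin. Qed.

Lemma measurable_nu_pow n (A : set (n.-tuple S)) : measurable A ->
  measurable_fun [set: PS S R] (fun nu : PS S R => nu_pow nu A).
Proof.
move=> mA; apply: (measurable_iprod (p := id) _ (f := fun z => (\1_A z.2)%:E)) => //.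
apply/measurable_EFinP.
exact: (measurableT_comp (@measurable_indic _ _ R setT A mA) measurable_snd).
Qed.

Lemma iprod_le1 (nu : probability S R) n (f : n.-tuple S -> \bar R) :
  measurable_fun setT f -> (forall t, 0 <= f t <= 1) -> iprod nu f <= 1.
Proof.
elim: n f => [|n ih] f mf f01 /=; first by case/andP: (f01 [tuple]).
have f0 t : 0 <= f t by case/andP: (f01 t).
apply: (@le_trans _ _ (\int[nu]_x cst 1 x)); last first.
  by rewrite integral_cst// mul1e; exact: probability_le1.
apply: ge0_le_integral => //.
- by move=> x _; exact: iprod_ge0.
- apply: (measurable_iprod (p := fun=> nu) _ (f := fun z => f (cons_tuple z.1 z.2))) => //.
  apply: (measurableT_comp mf).
  by apply: measurable_cons; [exact: measurable_fst|exact: measurable_snd].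
- move=> x _; apply: ih => //.
  apply: (measurableT_comp mf).
  by apply: measurable_cons; [exact: measurable_cst|exact: measurable_id].
Qed.

Lemma nu_pow_le1 n (nu : probability S R) (A : set (n.-tuple S)) :
  measurable A -> nu_pow nu A <= 1.
Proof.
move=> mA; apply: iprod_le1; first by apply/measurable_EFinP; exact: measurable_indic.
by move=> t; rewrite !lee_fin indicE ler0n lern1 leq_b1.
Qed.

Lemma nu_pow_set1 n (nu : probability S R) (s : n.-tuple S) :
  (forall i, measurable [set tnth s i]) ->
  nu_pow nu [set s] = \prod_(i < n) nu [set tnth s i].
Proof.
rewrite /nu_pow; elim: n s => [|n ih] s ms.
  by rewrite big_ord0/= indicE mem_set//= [s]tuple0.
case/tupleP: s ms => s0 s ms.
have e0 : tnth [tuple of s0 :: s] ord0 = s0 by rewrite tnth0.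
have eS i : tnth [tuple of s0 :: s] (lift ord0 i) = tnth s i by rewrite tnthS.
have ms0 : measurable [set s0] by rewrite -e0.
have {}ms i : measurable [set tnth s i] by rewrite -eS.
rewrite big_ord_recl e0 (eq_bigr (fun i => nu [set tnth s i])); last first.
  by move=> i _; rewrite eS.
rewrite -(ih s ms) /=.
have tE x (t : n.-tuple S) : (cons_tuple x t = [tuple of s0 :: s]) = (x = s0 /\ t = s).
  apply/propext; split=> [e|[-> ->]]; last exact: val_inj.
  by have [-> /val_inj ->] : x :: t = s0 :: s by exact: (congr1 (@tval _ _) e).
(* The indicator of the word [s0 :: s] factors into those of its head and its tail. *)
rewrite (eq_integral (fun x => (\1_[set s0] x)%:E *
    iprod nu (fun t => (\1_[set s] t)%:E))); last first.
  move=> x _; rewrite indicE; have [xs|xs] := pselect (x = s0).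
    rewrite mem_set// mul1e; apply: eq_iprod => t; rewrite !indicE; congr ((nat_of_bool _)%:R%:E).
    apply/idP/idP; rewrite !inE /= tE; first by case.
    by split.
  rewrite memNset// mul0e -(iprod0 nu n); apply: eq_iprod => t.
  by rewrite indicE memNset//= tE => -[/xs].
rewrite ge0_integralZr//; last 2 first.
  by apply/measurable_EFinP; exact: measurable_indic.
  by apply: iprod_ge0 => t; rewrite lee_fin.
by rewrite integral_indic// setIT.
Qed.

End iterated_product.

(** * Finite combinations of measures and finitely supported laws *)

Section measure_combinations.
Context {R : realType} {d : measure_display} {T : measurableType d}.
Local Open Scope ereal_scope.

Fixpoint mcomb (s : seq ({nonneg R} * {measure set T -> \bar R})) : {measure set T -> \bar R} :=
  if s is a :: s' then measure_add (mscale a.1 a.2) (mcomb s') else mzero.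

Lemma mcombE s A : mcomb s A = \sum_(a <- s) (a.1%:num)%:E * a.2 A.
Proof.
elim: s => [|a s ih]; first by rewrite big_nil.
by rewrite big_cons -ih; exact: measure_addE.
Qed.

Lemma integral_mcomb s f : measurable_fun [set: T] f -> (forall x, 0 <= f x) ->
  \int[mcomb s]_x f x = \sum_(a <- s) (a.1%:num)%:E * \int[a.2]_x f x.
Proof.
move=> mf f0; elim: s => [|a s ih]; first by rewrite big_nil integral_measure_zero.
by rewrite big_cons/= ge0_integral_measure_add//= ge0_integral_mscale// ih.
Qed.

End measure_combinations.

Section weighted_dirac.
Context {R : realType} {d : measure_display} {T : measurableType d} {J : finType}.
Variables (w : J -> R) (w0 : forall j, (0 <= w j)%R) (p : J -> T).
Local Open Scope ereal_scope.

Definition wdirac_seq : seq ({nonneg R} * {measure set T -> \bar R}) :=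
  [seq (NngNum (w0 j), \d_(p j) : {measure set T -> \bar R}) | j <- index_enum J].

(** The proof of total mass one is an argument, so that the term can carry the instance of a
    probability measure. *)
Definition wdirac (_ : (\sum_j w j = 1)%R) : set T -> \bar R := mcomb wdirac_seq.

Hypothesis w1 : (\sum_j w j = 1)%R.

HB.instance Definition _ := Measure.on (wdirac w1).

Lemma wdiracE A : wdirac w1 A = (\sum_j w j * \1_A (p j))%:E.
Proof. by rewrite /wdirac mcombE big_map -sumEFin. Qed.

Lemma wdirac_setT : wdirac w1 setT = 1.
Proof.
by rewrite wdiracE -w1; congr EFin; apply: eq_bigr => j _; rewrite indicT mulr1.
Qed.

HB.instance Definition _ := Measure_isProbability.Build _ _ _ (wdirac w1) wdirac_setT.

Lemma integral_wdirac f : measurable_fun [set: T] f -> (forall x, 0 <= f x) ->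
  \int[wdirac w1]_x f x = \sum_j (w j)%:E * f (p j).
Proof.
move=> mf f0; rewrite integral_mcomb// big_map; apply: eq_bigr => j _ /=.
by rewrite integral_dirac//= diracT mul1e.
Qed.

End weighted_dirac.

Section iprod_wdirac.
Context {R : realType} {d : measure_display} {S : measurableType d} {J : finType}.
Local Open Scope ereal_scope.

Definition fcons n (j : J) (g : {ffun 'I_n -> J}) : {ffun 'I_n.+1 -> J} :=
  [ffun i => oapp g j (unlift ord0 i)].

Lemma fcons0 n j (g : {ffun 'I_n -> J}) : fcons j g ord0 = j.
Proof. by rewrite ffunE unlift_none. Qed.

Lemma fconsS n j (g : {ffun 'I_n -> J}) i : fcons j g (lift ord0 i) = g i.
Proof. by rewrite ffunE liftK. Qed.

Lemma big_ffunS n (F : {ffun 'I_n.+1 -> J} -> \bar R) :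
  \sum_f F f = \sum_j \sum_(g : {ffun 'I_n -> J}) F (fcons j g).
Proof.
rewrite pair_bigA /= (reindex (fun p : J * {ffun 'I_n -> J} => fcons p.1 p.2))//.
exists (fun f : {ffun 'I_n.+1 -> J} => (f ord0, [ffun i => f (lift ord0 i)])) => [[j g] _|f _] /=.
  by rewrite fcons0; congr pair; apply/ffunP => i; rewrite ffunE fconsS.
by apply/ffunP => i; rewrite ffunE; case: unliftP => [k ->|->] //=; rewrite ffunE.
Qed.

(** The power of a finitely supported law lives on words [g] over [J], weighted by the product of
    the weights of their letters; integrating the first coordinate splits off the first letter. *)
Lemma iprod_wdirac (w : J -> R) w0 w1 (p : J -> S) n (f : n.-tuple S -> \bar R) :
  measurable_fun setT f -> (forall t, 0 <= f t) ->
  iprod (@wdirac R d S J w w0 p w1 : probability S R) f =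
  \sum_(g : {ffun 'I_n -> J}) (\prod_i w (g i))%:E * f [tuple p (g i) | i < n].
Proof.
elim: n f => [|n ih] f mf f0.
  rewrite (big_pred1 (ffun0 (card_ord 0) : {ffun 'I_0 -> J})).
    by rewrite big_ord0 mul1e /=; congr f; rewrite [RHS]tuple0.
  by move=> g; apply/esym/eqP/ffunP => -[].
rewrite /= integral_wdirac; last 2 first.
- apply: (measurable_iprod (p := fun=> wdirac w0 p w1) _
    (f := fun z => f (cons_tuple z.1 z.2))) => //.
  apply: (measurableT_comp mf).
  by apply: measurable_cons; [exact: measurable_fst|exact: measurable_snd].
- by move=> x; exact: iprod_ge0.
rewrite big_ffunS; apply: eq_bigr => j _.
rewrite ih; last 2 first.
- apply: (measurableT_comp mf).
  by apply: measurable_cons; [exact: measurable_cst|exact: measurable_id].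
- by move=> t; exact: f0.
rewrite ge0_sume_distrr; last first.
  by move=> g _; rewrite mule_ge0// lee_fin prodr_ge0.
apply: eq_bigr => g _; rewrite muleA -EFinM; congr (_%:E * f _).
  by rewrite big_ord_recl fcons0; congr (_ * _)%R; apply: eq_bigr => i _; rewrite fconsS.
apply: eq_from_tnth => i; rewrite tnth_mktuple; case: (unliftP ord0 i) => [k ->|->].
  by rewrite fconsS tnthS tnth_mktuple.
by rewrite fcons0 tnth0.
Qed.

End iprod_wdirac.

(** * Integrals and variation of combinations of probability measures *)

Section charge_combinations.
Context {R : realType} {d : measure_display} {T : measurableType d}.
Implicit Types (la : {charge set T -> \bar R}).
Local Open Scope ereal_scope.

Lemma ex_charge_comb (s : seq (R * probability T R)) :
  exists la, forall A, la A = \sum_(a <- s) a.1%:E * a.2 A.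
Proof.
elim: s => [|a s [la ih]].
  by exists czero => A; rewrite big_nil.
exists (cadd (cscale a.1 (charge_of_finite_measure a.2)) la) => A.
by rewrite big_cons -ih.
Qed.

Lemma jordan_hahn_sig la : exists Lp Ln : {finite_measure set T -> \bar R},
  [/\ forall A, measurable A -> la A = Lp A - Ln A,
      forall f, cintegral la f = \int[Lp]_x f x - \int[Ln]_x f x &
      tvnorm la = Lp setT + Ln setT].
Proof.
rewrite /cintegral /tvnorm; set h := projT2 _.
exists (jordan_pos h), (jordan_neg h); split=> // A mA.
by rewrite (jordan_decomp h mA) /cadd/= cscaleN1.
Qed.

Lemma integral_unit_fin_num (mu : {finite_measure set T -> \bar R}) (f : T -> \bar R) :
  measurable_fun [set: T] f -> (forall x, 0 <= f x <= 1) -> \int[mu]_x f x \is a fin_num.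
Proof.
move=> mf f01; have f0 x : 0 <= f x by case/andP: (f01 x).
rewrite ge0_fin_numE; last exact: integral_ge0.
apply: (@le_lt_trans _ _ (\int[mu]_x cst 1 x)).
  by apply: ge0_le_integral => // x _; case/andP: (f01 x).
by rewrite integral_cst// mul1e ltey_eq fin_num_measure.
Qed.

(** The terms with positive and with negative [a j] need not form the Jordan parts of [la]. Moving
    the subtracted measures across gives [Lp + \sum_j an j P_j = Ln + \sum_j ap j P_j], an identity
    of measures that can be integrated. *)
Lemma cintegral_comb (J : finType) (a : J -> R) (P : J -> probability T R) la (f : T -> \bar R)
    (c : J -> R) :
  (forall A, measurable A -> la A = \sum_j (a j)%:E * P j A) ->
  measurable_fun [set: T] f -> (forall x, 0 <= f x <= 1) ->
  (forall j, \int[P j]_x f x = (c j)%:E) ->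
  cintegral la f = (\sum_j a j * c j)%:E.
Proof.
move=> laE mf f01 fc; have f0 x : 0 <= f x by case/andP: (f01 x).
have [Lp [Ln [LE -> _]]] := jordan_hahn_sig la.
pose ap := sgn_part true a; pose an := sgn_part false a.
have ap0 j : (0 <= ap j)%R by exact: sgn_part_ge0.
have an0 j : (0 <= an j)%R by exact: sgn_part_ge0.
have aE j : a j = (ap j - an j)%R by exact: (sgn_partE _ _).1.
pose sp := [seq (NngNum (ap0 j), P j : {measure set T -> \bar R}) | j <- index_enum J].
pose sn := [seq (NngNum (an0 j), P j : {measure set T -> \bar R}) | j <- index_enum J].
have eqm A : measurable A -> measure_add Lp (mcomb sn) A = measure_add Ln (mcomb sp) A.
  move=> mA; have := LE A mA; rewrite laE// !measure_addE !mcombE !big_map /=.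
  have pf j : P j A = (fine (P j A))%:E by rewrite fineK// fin_num_measure.
  have sE (q : J -> R) : \sum_j (q j)%:E * P j A = (\sum_j q j * fine (P j A))%:E.
    by rewrite -sumEFin; apply: eq_bigr => j _; rewrite EFinM -pf.
  rewrite !sE.
  rewrite -(fineK (fin_num_measure Lp _ mA)) -(fineK (fin_num_measure Ln _ mA)).
  rewrite -!EFinD => -[e]; congr EFin; move: e.
  rewrite (eq_bigr (fun j => ap j * fine (P j A) - an j * fine (P j A))%R).
    by rewrite sumrB; lra.
  by move=> j _; rewrite aE mulrBl.
have := eq_measure_integral (measure_add Ln (mcomb sp)) (m1 := measure_add Lp (mcomb sn))
  (D := setT) (f := f) (fun A mA _ => eqm A mA).
rewrite !ge0_integral_measure_add// !integral_mcomb// !big_map /=.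
have sE (q : J -> R) : \sum_j (q j)%:E * \int[P j]_x f x = (\sum_j q j * c j)%:E.
  by rewrite -sumEFin; apply: eq_bigr => j _; rewrite EFinM -fc.
rewrite !sE.
rewrite -(fineK (integral_unit_fin_num Lp mf f01)) -(fineK (integral_unit_fin_num Ln mf f01)).
rewrite -!EFinD => -[e]; congr EFin.
rewrite (eq_bigr (fun j => ap j * c j - an j * c j)%R); last by move=> j _; rewrite aE mulrBl.
by rewrite sumrB; move: e; lra.
Qed.

(** The variation is [la] of the positive Hahn set minus [la] of the negative one, and each [P j]
    contributes a difference in [[-1, 1]]. *)
Lemma tvnorm_comb (J : finType) (a : J -> R) (P : J -> probability T R) la :
  (forall A, measurable A -> la A = \sum_j (a j)%:E * P j A) ->
  tvnorm la <= (\sum_j `|a j|)%:E.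
Proof.
move=> laE; rewrite /tvnorm /charge_variation; set h := projT2 _.
have [[mP _] [mN _] _ _] := h.
rewrite jordan_posE cjordan_posE jordan_negE cjordan_negE /crestr0 mem_set// /crestr !setTI.
rewrite !laE//.
have pf j A : measurable A -> P j A = (fine (P j A))%:E.
  by move=> mA; rewrite fineK// fin_num_measure.
have f01 j A : measurable A -> (0 <= fine (P j A) <= 1)%R.
  by move=> mA; rewrite -!lee_fin -pf// measure_ge0 probability_le1.
have sE A : measurable A -> \sum_j (a j)%:E * P j A = (\sum_j a j * fine (P j A))%:E.
  by move=> mA; rewrite -sumEFin; apply: eq_bigr => j _; rewrite EFinM -pf.
rewrite !sE// -EFinB -sumrB lee_fin; apply: ler_sum => j _; rewrite -mulrBr.
rewrite (le_trans (ler_norm _))// normrM ler_piMr//.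
by have := f01 j _ mP; have := f01 j _ mN; rewrite ler_norml; lra.
Qed.

Lemma fin_num_tvnorm la : tvnorm la \is a fin_num.
Proof. by rewrite /tvnorm fin_num_measure. Qed.

(** This integrates the pointwise bound; the negative coefficients are first moved to the right so
    that all integrands are nonnegative. *)
Lemma integral_comb_le (mu : {finite_measure set T -> \bar R}) (J : finType)
    (F : J -> T -> R) (phi : J -> R) (B : R) :
  (forall j, measurable_fun [set: T] (F j)) -> (forall j x, (0 <= F j x <= 1)%R) ->
  (0 <= B)%R -> (forall x, (\sum_j phi j * F j x <= B)%R) ->
  (\sum_j phi j * fine (\int[mu]_x (F j x)%:E) <= B * fine (mu setT))%R.
Proof.
move=> mF F01 B0 hB.
have F0 j x : (0 <= F j x)%R by case/andP: (F01 j x).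
pose pp := sgn_part true phi; pose pn := sgn_part false phi.
have pp0 j : (0 <= pp j)%R by exact: sgn_part_ge0.
have pn0 j : (0 <= pn j)%R by exact: sgn_part_ge0.
have pE j : phi j = (pp j - pn j)%R by exact: (sgn_partE _ _).1.
have mEF j : measurable_fun [set: T] (fun x => (F j x)%:E) by exact/measurable_EFinP.
have intf j : \int[mu]_x (F j x)%:E \is a fin_num.
  by apply: integral_unit_fin_num => // x; rewrite !lee_fin.
have intE (q : J -> R) : (forall j, (0 <= q j)%R) ->
    \int[mu]_x (\sum_j (q j)%:E * (F j x)%:E) = (\sum_j q j * fine (\int[mu]_x (F j x)%:E))%:E.
  move=> q0; rewrite ge0_integral_sum//; last 2 first.
  - by move=> j; exact: measurable_funeM.
  - by move=> j x _; rewrite mule_ge0// lee_fin.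
  rewrite -sumEFin; apply: eq_bigr => j _; rewrite ge0_integralZl_EFin//.
    by rewrite EFinM fineK.
  by move=> x _; rewrite lee_fin.
have mS (q : J -> R) : measurable_fun [set: T] (fun x => \sum_j (q j)%:E * (F j x)%:E).
  by apply: emeasurable_sum => j; exact: measurable_funeM.
have S0 (q : J -> R) x : (forall j, (0 <= q j)%R) -> 0 <= \sum_j (q j)%:E * (F j x)%:E.
  by move=> q0; apply: sume_ge0 => j _; rewrite mule_ge0// lee_fin.
have : \int[mu]_x (\sum_j (pp j)%:E * (F j x)%:E) <=
       \int[mu]_x (cst B%:E x + \sum_j (pn j)%:E * (F j x)%:E).
  apply: ge0_le_integral => //.
  - by move=> x _; exact: S0.
  - by apply: emeasurable_funD => //; exact: measurable_cst.
  - move=> x _; rewrite -[cst _ _]/(B%:E); under eq_bigr do rewrite -EFinM.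
    under [X in _ <= _ + X]eq_bigr do rewrite -EFinM.
    rewrite !sumEFin -EFinD lee_fin -lerBlDr -sumrB; under eq_bigr do rewrite -mulrBl -pE.
    exact: hB.
rewrite ge0_integralD//; last by move=> x _; exact: S0.
have cE : \int[mu]_x cst B%:E x = (B * fine (mu setT))%:E.
  by rewrite integral_cst// EFinM fineK// fin_num_measure.
rewrite !intE// cE -EFinD lee_fin.
rewrite [in X in _ -> X](eq_bigr (fun j => pp j * fine (\int[mu]_x (F j x)%:E) -
    pn j * fine (\int[mu]_x (F j x)%:E))%R); last by move=> j _; rewrite pE mulrBl.
by rewrite sumrB; lra.
Qed.

End charge_combinations.

(** * From tensor representations to signed measures on [P(S)] *)

Section representation.
Context {R : realType} {d : measure_display} {S : measurableType d} {n m : nat}.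
Local Open Scope ereal_scope.

(** It suffices to test the generating sets [{nu | nu A < r}], and here [nu A] is a finite weighted
    sum of indicators of [A] at the points [sigma i x]. *)
Lemma measurable_wdirac dT (T : measurableType dT) (y : 'I_m -> R) y0 y1
    (sigma : 'I_m -> T -> S) : (forall i, measurable_fun [set: T] (sigma i)) ->
  measurable_fun [set: T]
    (fun x => @wdirac R d S 'I_m y y0 (sigma ^~ x) y1 : pprobability S R).
Proof.
move=> ms; apply: (measurability (@pset _ _ _ : set (set (pprobability S R)))) => //.
move=> _ -[_ [r r01] [A mA <-]] <-; rewrite /mset /preimage/=.
apply: emeasurable_fun_infty_o => //.
under eq_fun do rewrite wdiracE; apply/measurable_EFinP.
apply: measurable_sum => i; apply: measurable_funM => //.
exact: (measurableT_comp (@measurable_indic _ _ R setT A mA) (ms i)).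
Qed.

(* Mixing the point masses at [sigma x 0], ..., [sigma x (m-1)] with weights [y_l]
   turns a representation of the tensor [t] into a signed measure on [P(S)]. *)
Lemma signed_mixture dT (T : measurableType dT) (mu : probability T R)
    (sigma : 'I_m -> T -> S) k (t : tensor R 'I_m n) r :
  (forall i, measurable_fun [set: T] (sigma i)) -> srep k t r ->
  exists la : {charge set PS S R -> \bar R}, tvnorm la <= r%:E /\
  forall A : set (n.-tuple S), measurable A ->
    cintegral la (fun nu : probability S R => nu_pow nu A) =
    (\sum_(g : {ffun 'I_n -> 'I_m})
      t g * fine (mu [set x | A [tuple sigma (g i) x | i < n]]))%:E.
Proof.
move=> ms [a [y [hy -> ha]]].
(* [phi l] is a random measure, [P l] its law under [mu], and [la] the combination of these laws
   with coefficients [a l]. *)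
pose phi l : T -> PS S R := fun x => wdirac (hy l).1 (sigma ^~ x) (hy l).2.
have mphi l : measurable_fun [set: T] (phi l) by exact: measurable_wdirac.
pose F l : {mfun T >-> PS S R} := HB.pack (phi l) (isMeasurableFun.Build _ _ _ _ (phi l) (mphi l)).
pose P l : probability (PS S R) R := distribution mu (F l).
have [la laE] := ex_charge_comb [seq (a l, P l) | l <- index_enum 'I_k].
have {}laE A : measurable A -> la A = \sum_l (a l)%:E * P l A by rewrite laE big_map.
exists la; split.
  by apply: le_trans (tvnorm_comb laE) _; rewrite lee_fin.
move=> A mA.
pose At (g : {ffun 'I_n -> 'I_m}) := [set x | A [tuple sigma (g i) x | i < n]].
have mAt g : measurable (At g).
  rewrite -[At g]setTI.
  apply: (_ : measurable_fun setT (fun x => [tuple sigma (g i) x | i < n])) => //.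
  apply/measurable_fun_tnthP => i; apply: eq_measurable_fun (ms (g i)) => x _ /=.
  by rewrite tnth_mktuple.
have powE l x : nu_pow (phi l x) A =
    \sum_(g : {ffun 'I_n -> 'I_m}) (\prod_i y l (g i))%:E * (\1_(At g) x)%:E.
  by rewrite /nu_pow iprod_wdirac//; apply/measurable_EFinP; exact: measurable_indic.
rewrite (@cintegral_comb _ _ _ _ _ _ _ _ (fun l =>
  \sum_(g : {ffun 'I_n -> 'I_m}) (\prod_i y l (g i)) * fine (mu (At g)))%R laE).
- congr EFin; rewrite /tcomb /elem_tensor.
  under eq_bigr do rewrite mulr_sumr.
  rewrite exchange_big; apply: eq_bigr => g _; rewrite mulr_suml.
  by apply: eq_bigr => l _; rewrite mulrA.
- exact: measurable_nu_pow.
- by move=> nu; rewrite nu_pow_ge0 nu_pow_le1.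
- move=> l; rewrite ge0_integral_pushforward//; last 2 first.
    exact: measurable_nu_pow.
    by move=> nu _; exact: nu_pow_ge0.
  rewrite preimage_setT; under eq_integral => x _ do rewrite /= powE.
  rewrite ge0_integral_sum//; last 2 first.
    by move=> g; apply: measurable_funeM; apply/measurable_EFinP; exact: measurable_indic.
    by move=> g x _; rewrite mule_ge0// lee_fin prodr_ge0// => i _; exact: (hy l).1.
  rewrite -sumEFin; apply: eq_bigr => g _; rewrite ge0_integralZl_EFin//; last 2 first.
    by apply/measurable_EFinP; exact: measurable_indic.
    by rewrite prodr_ge0// => i _; exact: (hy l).1.
  by rewrite integral_indic// setIT EFinM fineK// fin_num_measure.
Qed.

End representation.

(** * Lower bound for the norm of a representing signed measure *)

Section lower_bound.
Context {R : realType} {d : measure_display} {S : measurableType d} {n m : nat}.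
Variables (sigma : 'I_m -> S) (sigma_inj : injective sigma).
Hypothesis msigma : forall i, measurable [set sigma i].

Lemma measurable_tuple_set1 (s : n.-tuple S) :
  (forall i, measurable [set tnth s i]) -> measurable [set s].
Proof.
move=> ms.
have -> : [set s] = \bigcap_(i in [set: 'I_n]) ((@tnth n S)^~ i @^-1` [set tnth s i]).
  apply/seteqP; split=> [_ -> //|t h]; apply: eq_from_tnth => i.
  exact: (h i I).
apply: fin_bigcap_measurable => [|i _]; first exact: finite_finset.
by rewrite -[X in measurable X]setTI; apply: measurable_tnth.
Qed.

Lemma measurable_sigma_tuple (g : 'I_n -> 'I_m) : measurable [set [tuple sigma (g i) | i < n]].
Proof. by apply: measurable_tuple_set1 => i; rewrite tnth_mktuple. Qed.

Lemma sum_atoms_le1 (nu : probability S R) : \sum_i fine (nu [set sigma i]) <= 1.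
Proof.
have := @integral_comb_le R d S nu 'I_m (fun i => \1_[set sigma i]) (fun=> 1) 1.
have -> : fine ((nu : {finite_measure set S -> \bar R}) setT) = 1.
  exact: (congr1 fine (probability_setT nu)).
rewrite mulr1 => h; apply: le_trans (h _ _ _ _) => //.
- by apply: ler_sum => i _; rewrite mul1r integral_indic// setIT.
- by move=> i x; rewrite indicE ler0n lern1 leq_b1.
move=> x; have [[i xi]|nx] := pselect (exists i, x = sigma i).
  rewrite (bigD1 i)//= big1 ?addr0 ?mul1r ?indicE ?lern1 ?leq_b1//.
  move=> k ki; rewrite indicE memNset ?mulr0// xi => /sigma_inj e.
  by rewrite e eqxx in ki.
rewrite big1// => i _; rewrite indicE memNset ?mulr0// => xi.
by apply: nx; exists i.
Qed.

(* Otherwise a linear form would separate the atoms of [mu] from all representable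
   tensors of cost [tvnorm la], and integrating it against [la] is contradictory. *)
Lemma pis_norm_le_tvnorm (la : {charge set PS S R -> \bar R}) (mu : set (n.-tuple S) -> \bar R) :
  (0 < m)%N -> (0 < n)%N -> represents la mu ->
  (pis_norm (fun j : 'I_n -> 'I_m => fine (mu [set [tuple sigma (j i) | i < n]])) <= tvnorm la)%E.
Proof.
move=> m0 n0 rep; set t := (X in pis_norm X).
have [Lp [Ln [_ iE tE]]] := jordan_hahn_sig la.
have tf := fin_num_tvnorm la; rewrite -(fineK tf); set r := fine (tvnorm la).
have rE : r = fine (Lp setT) + fine (Ln setT).
  by rewrite /r tE fineD// fin_num_measure.
have Lp0 : 0 <= fine (Lp setT) by rewrite fine_ge0.
have Ln0 : 0 <= fine (Ln setT) by rewrite fine_ge0.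
have r0 : 0 <= r by rewrite rE addr_ge0.
apply: pis_norm_le; apply: contrapT => /(prep_separation m0 n0 r0)[phi [b [hb]]].
apply/negP; rewrite -leNgt.
(* The vector [x nu] of atoms has sum at most 1, so [c] times its tensor power has cost at most
   [|c|]; [F g nu] is the entry of that power at [g]. *)
pose x (nu : PS S R) i := fine ((nu : probability S R) [set sigma i]).
have x0 nu i : 0 <= x nu i by rewrite fine_ge0.
pose F (g : {ffun 'I_n -> 'I_m}) nu := \prod_i x nu (g i).
have mx i : measurable_fun [set: PS S R] (x ^~ i).
  apply: (measurableT_comp (f := fine)) => //.
  exact: (measurable_kernel (kprobability (@measurable_id _ (PS S R) setT)) _ (msigma i)).
have mF g : measurable_fun [set: PS S R] (F g) by apply: measurable_prod => i _; exact: mx.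
have F01 g nu : 0 <= F g nu <= 1.
  rewrite prodr_ge0//=; apply: prodr_ile1 => i _; rewrite x0/=.
  by rewrite -lee_fin fineK ?fin_num_measure// probability_le1.
have Fprep nu c : `|c| <= r -> prep (fun j : 'I_n -> 'I_m => c * \prod_i x nu (j i)) r.
  move=> cr; have h (_ : 'I_1) : in_l1 (x nu) /\ vpos (x nu).
    by split; [exact: in_l1_ord|exact: x0].
  apply: prep_ext (prep_le (prep_fin (fun _ : 'I_1 => c) h) _) _ => [|j]; last first.
    by rewrite big_ord1.
  rewrite big_ord1 l1norm_ord/= (le_trans _ cr)// ler_piMr// exprn_ile1//.
    exact: sumr_ge0.
  rewrite (eq_bigr (fun i => fine ((nu : probability S R) [set sigma i]))).
    exact: sum_atoms_le1.
  by move=> i _; rewrite ger0_norm.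
(* Taking [c = r] and [c = -r] bounds the form on powers by [b / r]. If [r = 0] this says nothing,
   but then any uniform bound, such as [\sum_g |phi g|], will do. *)
have [B [B0 hB Br]] : exists B, [/\ 0 <= B, forall nu, `|\sum_g phi g * F g nu| <= B & B * r <= b].
  have hF nu c : `|c| <= r -> c * \sum_g phi g * F g nu <= b.
    move=> cr; apply: le_trans (hb _ (Fprep nu c cr)).
    by rewrite mulr_sumr; apply: ler_sum => g _; rewrite mulrCA.
  have b0 : 0 <= b.
    have := hb _ (prep_le prep0 r0); rewrite big1// => g _.
    by rewrite mulr0.
  have [->|rn0] := eqVneq r 0.
    exists (\sum_g `|phi g|); split; [exact: sumr_ge0| |by rewrite mulr0].
    move=> nu; apply: le_trans (ler_norm_sum _ _ _) _; apply: ler_sum => g _.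
    by have /andP[Fg0 Fg1] := F01 g nu; rewrite normrM ler_piMr// ger0_norm.
  have rp : 0 < r by rewrite lt_def rn0.
  exists (b / r); split; [exact: divr_ge0| |by rewrite divfK].
  move=> nu; rewrite ler_pdivlMr//; have [h|h] := leP 0 (\sum_g phi g * F g nu).
    by rewrite ger0_norm// mulrC hF// ger0_norm.
  by rewrite ltr0_norm// mulNr mulrC -mulNr hF// normrN ger0_norm.
have tgE (g : {ffun 'I_n -> 'I_m}) :
    t g = fine (\int[Lp]_nu (F g nu)%:E)%E - fine (\int[Ln]_nu (F g nu)%:E)%E.
  rewrite /t rep; last exact: measurable_sigma_tuple.
  have pE : (fun nu : PS S R => nu_pow (nu : probability S R) [set [tuple sigma (g i) | i < n]]) =
      (fun nu => (F g nu)%:E).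
    apply/funext => nu; rewrite nu_pow_set1; last by move=> i; rewrite tnth_mktuple.
    rewrite /F -prodEFin; apply: eq_bigr => i _; rewrite tnth_mktuple.
    by rewrite fineK// fin_num_measure.
  have iF (L : {finite_measure set PS S R -> \bar R}) : (\int[L]_nu (F g nu)%:E)%E \is a fin_num.
    apply: integral_unit_fin_num; first by apply/measurable_EFinP; exact: mF.
    by move=> nu; rewrite !lee_fin F01.
  by rewrite pE iE fineB.
(* The form is integrated against [Lp] and its opposite against [Ln]; adding up, its value at [t] is
   at most [B * r <= b]. *)
have h1 : \sum_g phi g * fine (\int[Lp]_nu (F g nu)%:E)%E <= B * fine (Lp setT).
  by apply: integral_comb_le => // nu; exact: le_trans (ler_norm _) (hB nu).
have h2 : \sum_g (- phi g) * fine (\int[Ln]_nu (F g nu)%:E)%E <= B * fine (Ln setT).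
  apply: integral_comb_le => // nu; apply: le_trans (hB nu); rewrite -normrN.
  by apply: le_trans (ler_norm _); rewrite -sumrN; apply: ler_sum => g _; rewrite mulNr.
apply: le_trans Br; rewrite rE mulrDr; apply: le_trans (lerD h1 h2); rewrite -big_split/=.
by apply: ler_sum => g _; rewrite tgE mulrBr mulNr.
Qed.

End lower_bound.

(** * Tensors over finitely many coordinates *)

Section finite_tensors.
Context {R : realType} {m n : nat}.
Implicit Types (t : tensor R 'I_m n).
Local Notation nrm x := (fine (l1norm x)).

Lemma tensor_ordE t :
  t = tcomb (fun l : 'I_#|{ffun 'I_n -> 'I_m}| => t (enum_val l))
            (fun l i p => (p == (enum_val l : {ffun 'I_n -> 'I_m}) i)%:R).
Proof.
apply/funext => j; rewrite /tcomb /elem_tensor.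
rewrite -(big_enum_val (fun g : {ffun 'I_n -> 'I_m} => t g * \prod_i (j i == g i)%:R)).
rewrite (bigD1 [ffun i => j i])//= [X in _ + X]big1 ?addr0; last first.
  move=> g gj; have [i gi] : exists i, j i != g i.
    apply/existsP; rewrite -negb_forall; apply: contra gj => /forallP gj.
    by apply/eqP/ffunP => i; rewrite ffunE; exact/esym/eqP.
  by rewrite (bigD1 i)//= (negbTE gi) mul0r mulr0.
rewrite big1 ?mulr1; last by move=> i _; rewrite ffunE eqxx.
by congr t; apply/funext => i; rewrite ffunE.
Qed.

Lemma is_tensor_ord t : is_tensor t.
Proof. by do 3 eexists; split; [|exact: tensor_ordE]; move=> *; exact: in_l1_ord. Qed.

(** The expansion in the standard basis already has this cost. With the reverse inequality below,
    the projective norm over [ell_1^m] is the [ell_1] norm of the entries. *)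
Lemma pi_norm_le_sum t : (pi_norm t <= (\sum_(g : {ffun 'I_n -> 'I_m}) `|t g|)%:E)%E.
Proof.
apply: ereal_inf_lbound; do 3 eexists; split; [|exact: tensor_ordE|].
  by move=> *; exact: in_l1_ord.
congr EFin; rewrite (big_enum_val (fun g : {ffun 'I_n -> 'I_m} => `|t g|)).
apply: eq_bigr => l _; rewrite big1 ?mulr1// => i _.
by rewrite l1norm_indic.
Qed.

Lemma sum_le_pi_norm t : ((\sum_(g : {ffun 'I_n -> 'I_m}) `|t g|)%:E <= pi_norm t)%E.
Proof.
apply: le_ereal_inf_tmp => _ [k [a [x [h -> ->]]]]; rewrite lee_fin /tcomb /elem_tensor.
apply: (@le_trans _ _ (\sum_(g : {ffun 'I_n -> 'I_m}) \sum_l `|a l| * \prod_i `|x l i (g i)|)).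
  apply: ler_sum => g _; apply: le_trans (ler_norm_sum _ _ _) _; apply: ler_sum => l _.
  by rewrite normrM normr_prod.
rewrite exchange_big; apply: ler_sum => l _; rewrite -mulr_sumr ler_wpM2l//.
rewrite -(bigA_distr_bigA (fun i p => `|x l i p|)).
by under [leRHS]eq_bigr do rewrite l1norm_ord /=.
Qed.

End finite_tensors.

Lemma probability_atoms {R : realType} {d} {T : measurableType d} (J : finType)
    (tau : J -> T) (mu : probability T R) (A : set T) :
  injective tau -> (forall x, exists j, x = tau j) -> (forall j, measurable [set tau j]) ->
  measurable A -> mu A = (\sum_j fine (mu [set tau j]) * \1_A (tau j))%:E.
Proof.
move=> ti ts mt mA; rewrite -[in LHS](setIT A) -integral_indic//.
have iE x : ((\1_A x)%:E = \sum_j (\1_A (tau j))%:E * (\1_[set tau j] x)%:E :> \bar R)%E.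
  have [i ->] := ts x; rewrite (bigD1 i)//= [X in (_ + X)%E]big1 ?adde0.
    by rewrite [\1_[set tau i] _]indicE mem_set// mule1.
  move=> j ji; rewrite [\1_[set tau j] _]indicE memNset ?mule0// => /= /ti e.
  by rewrite e eqxx in ji.
under eq_integral do rewrite iE.
rewrite ge0_integral_sum//; last first.
  by move=> j; apply: measurable_funeM; apply/measurable_EFinP; exact: measurable_indic.
rewrite -sumEFin; apply: eq_bigr => j _; rewrite ge0_integralZl_EFin//; last first.
  by apply/measurable_EFinP; exact: measurable_indic.
rewrite integral_indic// setIT EFinM fineK ?fin_num_measure// muleC.
by [].
Qed.

(** * The constant [kappa] and exchangeable laws *)

Section kappa_theory.
Context {R : realType} {n : nat} (n0 : (0 < n)%N).

Lemma kappa_attained : exists r : R, kappa R n = r%:E /\ prep (@sym_basis R n) r.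
Proof.
have kf : kappa R n \is a fin_num.
  rewrite ge0_fin_numE ?pis_norm_ge0// (le_lt_trans (pis_norm_le (sym_basis_upper n0)))//.
  exact: ltry.
exists (fine (kappa R n)); rewrite fineK//; split=> //.
by apply: pis_norm_attained => //; rewrite fineK.
Qed.

Lemma kappa_ge : (((n ^ n)%:R / n`!%:R)%:E <= kappa R n)%E.
Proof. by have [r [-> hr]] := kappa_attained; rewrite lee_fin sym_basis_lower. Qed.

Lemma c_pis_le_kappa (I : choiceType) : (c_pis R I n <= kappa R n)%E.
Proof.
have [r [-> hr]] := kappa_attained; apply: c_pis_le => //.
apply: lt_le_trans (sym_basis_lower n0 hr).
by rewrite divr_gt0// ltr0n ?fact_gt0// expn_gt0 n0.
Qed.

Lemma c_pisE (I : choiceType) (h : 'I_n -> I) : injective h -> c_pis R I n = kappa R n.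
Proof. by move=> hi; apply/eqP; rewrite eq_le c_pis_le_kappa (kappa_le_c_pis hi). Qed.

End kappa_theory.

Section exchangeable_representation.
Context {R : realType} {n : nat} (n0 : (0 < n)%N).
Context {d : measure_display} {S : measurableType d}.

(** [signed_mixture] is applied with [sigma i] the [i]-th coordinate and the tensor [sym_basis]. The
    result is the average of the permuted copies of [mu], all equal to [mu] by exchangeability. *)
Lemma exchangeable_mixture (mu : probability (n.-tuple S) R) : exchangeable mu ->
  exists la : {charge set PS S R -> \bar R}, represents la mu /\ (tvnorm la <= kappa R n)%E.
Proof.
move=> ex; have [r [-> hr]] := kappa_attained (R := R) n0.
have /prepP - /(_ n0 n0) hs := hr.
have [la [tv ci]] := signed_mixture mu (fun i => @measurable_tnth d S n i) hs.
exists la; split=> // A mA; rewrite ci//.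
rewrite (sum_sym_basis (fun f => fine (mu [set x | A [tuple tnth x (f i) | i < n]]))).
rewrite (eq_bigr (fun _ => fine (mu A))); last first.
  by move=> s _; exact: (congr1 fine (ex s A mA)).
by rewrite sumr_const card_Sn -[fine _ *+ _]mulr_natl mulKf ?fineK ?fin_num_measure.
Qed.

Section atoms.
Context {m : nat} (sigma : 'I_m -> S) (sigma_inj : injective sigma).
Hypothesis msigma : forall i, measurable [set sigma i].

Definition stuple (g : 'I_n -> 'I_m) : n.-tuple S := [tuple sigma (g i) | i < n].

Lemma stuple_inj (g h : 'I_n -> 'I_m) : stuple g = stuple h -> g = h.
Proof.
move=> e; apply/funext => i; apply: sigma_inj.
by have := congr1 (fun t => tnth t i) e; rewrite !tnth_mktuple.
Qed.

Lemma permt_stuple (s : 'S_n) (g : 'I_n -> 'I_m) : permt s (stuple g) = stuple (g \o s).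
Proof. by apply: eq_from_tnth => i; rewrite !tnth_mktuple. Qed.

Lemma preimage_permt_stuple (s : 'S_n) (g : 'I_n -> 'I_m) :
  permt s @^-1` [set stuple (g \o s)] = [set stuple g].
Proof.
apply/seteqP; split=> [t /= e|_ ->]; last exact: permt_stuple.
apply: eq_from_tnth => i; have := congr1 (fun t => tnth t ((s^-1)%g i)) e.
by rewrite !tnth_mktuple /= permKV.
Qed.

Lemma measurable_stuple g : measurable [set stuple g].
Proof. exact: measurable_sigma_tuple. Qed.

Lemma is_sym_atoms (mu : set (n.-tuple S) -> \bar R) : exchangeable mu ->
  Defs.is_sym (fun g => fine (mu [set stuple g])).
Proof.
move=> ex s; apply/funext => g; congr fine.
by rewrite -(preimage_permt_stuple s g) ex//; exact: measurable_stuple.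
Qed.

Lemma exchangeable_wdirac (w : {ffun 'I_n -> 'I_m} -> R) w0 w1 :
  (forall (s : 'S_n) (g : {ffun 'I_n -> 'I_m}), w [ffun i => g (s i)] = w g) ->
  exchangeable (@wdirac R _ _ _ w w0 (fun g => stuple g) w1).
Proof.
move=> ws s A mA; rewrite !wdiracE; congr EFin.
rewrite [RHS](reindex_inj (h := fun g : {ffun 'I_n -> 'I_m} => [ffun i => g (s i)])); last first.
  move=> g h /ffunP e; apply/ffunP => i; have := e ((s^-1)%g i).
  by rewrite !ffunE permKV.
apply: eq_bigr => g _; rewrite ws; congr (_ * _).
rewrite -[LHS]/(\1_A (permt s (stuple g))) permt_stuple; congr (\1_A (stuple _)).
by apply/funext => i; rewrite ffunE.
Qed.

Lemma wdirac_atom (w : {ffun 'I_n -> 'I_m} -> R) w0 w1 (g : 'I_n -> 'I_m) :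
  fine (@wdirac R _ _ _ w w0 (fun g => stuple g) w1 [set stuple g]) = w [ffun i => g i].
Proof.
have gE : ([ffun i => g i] : 'I_n -> 'I_m) = g by apply/funext => i; rewrite ffunE.
rewrite wdiracE /= (bigD1 [ffun i => g i])//= [X in _ + X]big1 ?addr0.
  by rewrite indicE gE mem_set// mulr1.
move=> h hg; rewrite indicE memNset ?mulr0//= => /stuple_inj e.
by case/eqP: hg; apply/ffunP => i; rewrite ffunE e.
Qed.

End atoms.

End exchangeable_representation.

(** * Finite state spaces and optimality *)

Section finite_space.
Context {R : realType} {n m : nat} (n0 : (0 < n)%N) (m0 : (0 < m)%N).
Context {d : measure_display} {S : measurableType d}.
Variables (sigma : 'I_m -> S) (sigma_inj : injective sigma).
Hypothesis msigma : forall i, measurable [set sigma i].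

Local Notation tau := (fun g : {ffun 'I_n -> 'I_m} => stuple sigma g).

(** The tensor of atoms is symmetric with projective norm at most 1, so its positive norm is at most
    [c_pis]. A representation of that cost exists by attainment and goes into [signed_mixture] with
    constant maps. *)
Lemma finite_mixture (mu : probability (n.-tuple S) R) :
  (forall x, exists i, x = sigma i) -> exchangeable mu ->
  exists la : {charge set PS S R -> \bar R},
    represents la mu /\ (tvnorm la <= c_pis R 'I_m n)%E.
Proof.
move=> /choice[inv invE] ex.
pose t : tensor R 'I_m n := fun g => fine (mu [set stuple sigma g]).
have muE A : measurable A -> mu A = (\sum_g t (g : {ffun 'I_n -> 'I_m}) * \1_A (tau g))%:E.
  apply: probability_atoms.
  - by move=> g h /(stuple_inj sigma_inj) e; apply/ffunP => i; rewrite e.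
  - move=> x; exists [ffun i => inv (tnth x i)]; apply: eq_from_tnth => i.
    by rewrite tnth_mktuple ffunE -invE.
  - by move=> g; exact: measurable_stuple.
have t0 g : 0 <= t g by rewrite fine_ge0.
have sum1 : \sum_(g : {ffun 'I_n -> 'I_m}) `|t g| = 1.
  have := muE _ measurableT; rewrite probability_setT => -[->]; apply: eq_bigr => g _.
  by rewrite indicT mulr1 ger0_norm.
have tn0 : t <> (fun _ => 0).
  move=> te; have := sum1; rewrite big1 => [/esym/eqP|g _]; first by rewrite oner_eq0.
  by rewrite te normr0.
have tt := is_tensor_ord t.
have pi1 : fine (pi_norm t) <= 1.
  by rewrite -lee_fin fineK ?pi_norm_fin// -sum1 pi_norm_le_sum.
have tc : (pis_norm t <= c_pis R 'I_m n)%E.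
  apply: (@le_trans _ _ (pis_norm t * ((fine (pi_norm t))^-1)%:E)%E).
    rewrite -[leLHS]mule1; apply: lee_wpmul2l; first exact: pis_norm_ge0.
    by rewrite lee_fin invf_ge1// pi_norm_gt0.
  by apply: ereal_sup_ubound; exists t; split=> //; exact: is_sym_atoms.
have [r [kE _]] := kappa_attained (R := R) n0.
have cf : c_pis R 'I_m n \is a fin_num.
  rewrite ge0_fin_numE ?(le_trans (pis_norm_ge0 t))//.
  by rewrite (le_lt_trans (c_pis_le_kappa n0 _))// kE ltry.
have /prepP - /(_ m0 n0) hs : prep t (fine (c_pis R 'I_m n)).
  by apply: pis_norm_attained => //; rewrite fineK.
have [la [tv ci]] := signed_mixture mu (sigma := fun i _ => sigma i) (fun=> measurable_cst _) hs.
exists la; split; last by rewrite fineK in tv.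
move=> A mA; rewrite ci// muE//; congr EFin; apply: eq_bigr => g _; congr (_ * _).
(* As the maps are constant, the event in [signed_mixture] is either everything or empty. *)
rewrite indicE -/(stuple sigma g); have [Ag|nAg] := pselect (A (stuple sigma g)).
  by rewrite mem_set// (_ : [set _ | _] = setT) ?probability_setT//; apply/seteqP; split.
by rewrite memNset// (_ : [set _ | _] = set0) ?measure0//; apply/seteqP; split.
Qed.

(** Dividing a nonzero [t] by its mass gives an exchangeable law with tensor of atoms [t / s];
    [pis_norm_le_tvnorm] carries the bound on its representing measure over to the tensor. *)
Lemma prep_bound (M : R) (t : tensor R 'I_m n) :
  (forall mu : probability (n.-tuple S) R, exchangeable mu ->
     exists la : {charge set PS S R -> \bar R}, represents la mu /\ (tvnorm la <= M%:E)%E) ->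
  Defs.is_sym t -> (forall g, 0 <= t g) ->
  prep t (M * \sum_(g : {ffun 'I_n -> 'I_m}) t g).
Proof.
move=> hM ts t0; set s := \sum_g _.
have fE (g : 'I_n -> 'I_m) : t [ffun i => g i] = t g.
  by congr t; apply/funext => i; rewrite ffunE.
have s0 : 0 <= s by exact: sumr_ge0.
have [se|sn] := eqVneq s 0.
  rewrite se mulr0; apply: prep_ext prep0 _ => j; apply/esym/eqP; rewrite -fE.
  move: se => /eqP; rewrite psumr_eq0// => /allP h.
  exact: (h [ffun i => j i] (mem_index_enum _)).
pose w (g : {ffun 'I_n -> 'I_m}) := t g / s.
have w0 g : 0 <= w g by rewrite divr_ge0.
have w1 : \sum_g w g = 1 by rewrite -mulr_suml mulfV.
have [|la [rep tv]] := hM (wdirac w0 tau w1).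
  apply: exchangeable_wdirac => u g; congr (_ / s).
  by rewrite (fE (g \o u)) [in RHS](ts u).
have : prep (fun j => w [ffun i => j i]) M.
  apply: pis_norm_attained => //; apply: le_trans tv.
  have := pis_norm_le_tvnorm sigma_inj msigma m0 n0 rep.
  congr (_ <= _)%E; congr pis_norm; apply/funext => j; exact: wdirac_atom.
move=> /(prepZ s); rewrite ger0_norm// mulrC => h; apply: prep_ext h _ => j.
by rewrite /w mulrC divfK// fE.
Qed.

(** The positive and negative parts of a symmetric tensor are symmetric, and their masses add up to
    the sum of the [|t g|], which is at most the projective norm. *)
Lemma c_pis_le_bound (M : \bar R) :
  (forall mu : probability (n.-tuple S) R, exchangeable mu ->
     exists la : {charge set PS S R -> \bar R}, represents la mu /\ (tvnorm la <= M)%E) ->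
  (c_pis R 'I_m n <= M)%E.
Proof.
move=> hM; case: M hM => [M|_|hM]; [|exact: leey|]; last first.
  (* The value [-oo] is excluded by the point mass at a constant word, which is exchangeable, since
     total variations are finite. *)
  have [|la [_]] := hM (\d_ (stuple sigma (fun _ => Ordinal m0))).
    move=> s A mA; rewrite /= /dirac !indicE; congr ((nat_of_bool _)%:R%:E).
    by apply/idP/idP; rewrite !inE /preimage/= permt_stuple.
  by rewrite leeNy_eq => /eqP e; have := fin_num_tvnorm la; rewrite e.
move=> hM; apply: ge_ereal_sup => _ [t [tt ts tn0 ->]].
have p0 := pi_norm_gt0 tt tn0.
rewrite muleC lee_pdivrMl//.
pose sg b : tensor R 'I_m n := sgn_part b t.
have hsg b : prep (sg b) (M * \sum_(g : {ffun 'I_n -> 'I_m}) sg b g).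
  apply: prep_bound => // [s|g]; last exact: sgn_part_ge0.
  apply/funext => j; have e : t j = t (fun i => j (s i)) by rewrite {1}(ts s).
  by rewrite /sg /sgn_part e.
have ht : prep t (M * \sum_(g : {ffun 'I_n -> 'I_m}) `|t g|).
  have := prepD (hsg true) (prepZ (-1) (hsg false)); rewrite normrN1 mul1r -mulrDr -big_split/=.
  rewrite (eq_bigr (fun g : {ffun 'I_n -> 'I_m} => `|t g|)).
    move=> h; apply: prep_ext h _ => j; rewrite mulN1r; exact/esym/(sgn_partE _ _).1.
  by move=> g _; exact/esym/(sgn_partE _ _).2.
have sn0 : 0 < \sum_(g : {ffun 'I_n -> 'I_m}) `|t g|.
  apply: lt_le_trans p0 _; rewrite -lee_fin fineK ?pi_norm_fin//.
  exact: pi_norm_le_sum.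
have M0 : 0 <= M by rewrite -(pmulr_lge0 _ sn0) (prep_ge0 ht).
apply: le_trans (pis_norm_le ht) _; rewrite -EFinM lee_fin mulrC ler_wpM2r//.
by rewrite -lee_fin fineK ?pi_norm_fin// sum_le_pi_norm.
Qed.

End finite_space.

(** The extremal law is that of a uniformly random arrangement of [n] distinct points: its tensor of
    atoms is [sym_basis] itself. *)
Lemma kappa_optimal {R : realType} {n : nat} : (0 < n)%N ->
  exists mu : probability (n.-tuple nat) R, exchangeable mu /\
    forall la : {charge set PS nat R -> \bar R}, represents la mu -> (kappa R n <= tvnorm la)%E.
Proof.
move=> n0.
pose sigma (i : 'I_n) : nat := i.
have si : injective sigma by exact: ord_inj.
have sb0 g : 0 <= sym_basis R (g : 'I_n -> 'I_n).
  rewrite mulr_ge0// sumr_ge0// => s _; apply: prodr_ge0 => i _.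
  by rewrite /basis_vec; case: ifP.
pose w (g : {ffun 'I_n -> 'I_n}) := sym_basis R g.
have w0 g : 0 <= w g by exact: sb0.
have w1 : \sum_g w g = 1.
  have := sum_sym_basis (R := R) (n := n) (fun _ => 1).
  under eq_bigr do rewrite mulr1.
  by rewrite sumr_const card_Sn mulVf.
exists (wdirac w0 (fun g => stuple sigma g) w1); split.
  apply: exchangeable_wdirac => s g; rewrite /w /sym_basis; congr (_ * _).
  rewrite (reindex_inj (mulgI s)); apply: eq_bigr => u _; rewrite /elem_tensor.
  by rewrite [RHS](reindex_inj (@perm_inj _ s)); apply: eq_bigr => i _; rewrite ffunE permM.
move=> la rep; have := pis_norm_le_tvnorm si (fun=> I) n0 n0 rep.
congr (_ <= _)%E; congr pis_norm; apply/funext => j; rewrite wdirac_atom//.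
by rewrite /w; congr sym_basis; apply/funext => i; rewrite ffunE.
Qed.

Local Open Scope ereal_scope.

Theorem theorem7p1 (R : realType) (n : nat) (hn : (1 <= n)%N) :
  (* kappa(n) = c_{pi,s+}(n, ell_1) *)
  kappa R n = c_pis R nat n /\
  (* (i) existence of a representation with ||lambda|| <= kappa(n) *)
  (forall (d : measure_display) (S : measurableType d)
          (dO : measure_display) (Omega : measurableType dO)
          (P : probability Omega R) (X : {mfun Omega >-> n.-tuple S}),
      exchangeable (distribution P X) ->
      exists la : {charge set PS S R -> \bar R},
        represents la (distribution P X) /\ tvnorm la <= kappa R n) /\
  (* (i) optimality of kappa(n) *)
  (exists (d : measure_display) (S : measurableType d)
          (dO : measure_display) (Omega : measurableType dO)
          (P : probability Omega R) (X : {mfun Omega >-> n.-tuple S}),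
      exchangeable (distribution P X) /\
      forall la : {charge set PS S R -> \bar R},
        represents la (distribution P X) -> kappa R n <= tvnorm la) /\
  (* (i) bounds  n^n/n! <= kappa(n) <= 2^(n-1) n^n/n! *)
  (((n ^ n)%:R / (factorial n)%:R)%:E <= kappa R n /\
   kappa R n <= ((2 ^ (n - 1) * n ^ n)%:R / (factorial n)%:R)%:E) /\
  (* (ii) finite S with |S| = m (discrete sigma-field) *)
  (forall (m : nat) (d : measure_display) (S : measurableType d),
      (0 < m)%N ->
      (forall A : set S, measurable A) ->
      ([set: S] #= `I_m)%card ->
      (forall (dO : measure_display) (Omega : measurableType dO)
              (P : probability Omega R) (X : {mfun Omega >-> n.-tuple S}),
          exchangeable (distribution P X) ->
          exists la : {charge set PS S R -> \bar R},
            represents la (distribution P X) /\ tvnorm la <= c_pis R 'I_m n) /\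
      (forall M : \bar R,
          (forall mu : probability (n.-tuple S) R, exchangeable mu ->
             exists la : {charge set PS S R -> \bar R},
               represents la mu /\ tvnorm la <= M) ->
          c_pis R 'I_m n <= M) /\
      ((n <= m)%N -> c_pis R 'I_m n = kappa R n)).
Proof.
split; first by rewrite -(c_pisE hn (h := fun i : 'I_n => i : nat) (@ord_inj n)).
split; first by move=> d S dO Omega P X; exact: exchangeable_mixture.
split.
  have [mu [ex opt]] := kappa_optimal (R := R) hn.
  (* The space of words with the law [mu] serves as the probability space, and the identity as the
     random vector. *)
  pose X : {mfun n.-tuple nat >-> n.-tuple nat} :=
    HB.pack (@idfun (n.-tuple nat))
      (isMeasurableFun.Build _ _ _ _ (@idfun (n.-tuple nat)) (@measurable_id _ _ setT)).
  by exists _, nat, _, (n.-tuple nat)%type, mu, X.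
split.
  by split; [exact: kappa_ge|exact: pis_norm_le (sym_basis_upper hn)].
move=> m d S m0 mS cS.
have [f [fm fi fs]] := card_set_bijP cS.
have /choice[sigma fsigma] : forall i : 'I_m, exists x, f x = i.
  by move=> i; have [x _ <-] := fs i (ltn_ord i); exists x.
have si : injective sigma.
  by move=> i j e; apply: ord_inj; rewrite -!fsigma e.
have ss x : exists i, x = sigma i.
  have fx : (f x < m)%N by exact: fm.
  by exists (Ordinal fx); apply: fi; rewrite ?inE// fsigma.
split; first by move=> dO Omega P X; exact: (finite_mixture hn m0 si).
split; first by move=> M; exact: (c_pis_le_bound hn m0 si).
move=> nm; apply: (c_pisE hn (h := widen_ord nm)).
by move=> i j /(congr1 val)/= e; exact: ord_inj.
Qed.
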